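(* Let $\chi_{\alpha,\beta,\delta}$ be an indecomposable character of the algebra $\mathbb{C}[R_\infty]$, let $\chi_{\alpha,\beta}$ be the corresponding indecomposable character of the algebra $\mathbb{C}[S_\infty]$, and let $\sigma\in R_\infty$ be a reduced element. Then $$\chi_{\alpha,\beta,\delta}(\sigma)=\sum_{k=0}^{n(\sigma)}\Big(\delta^{n(\sigma)-k}(1-\delta)^{k}\cdot\sum_{\tilde\sigma\in M_k(\sigma)}\chi_{\alpha,\beta}(\tilde\sigma)\Big).$$
   Context: $R_n$ is the symmetric inverse semigroup: all injective partial maps from $\{1,\dots,n\}$ to itself, under composition where defined. $R_n\subset R_{n+1}$ by letting $n+1$ be fixed, and $R_\infty=\bigcup_nR_n$; $S_\infty=\bigcup_nS_n\subset R_\infty$. The indecomposable characters $\chi_{\alpha,\beta}$ of $\mathbb{C}[S_\infty]$ are indexed by the Thoma parameters $\alpha_1\ge\alpha_2\ge\dots\ge0$, $\beta_1\ge\beta_2\ge\dots\ge0$ with $\sum\alpha_i+\sum\beta_i\le1$ (the third parameter $\gamma=1-\sum\alpha_i-\sum\beta_i$ is omitted from the notation). The branching graph of $\mathbb{C}[S_\infty]$ is the Young graph $\mathbb Y$. The branching graph of $\mathbb{C}[R_\infty]$ is the slow Young graph $\tilde{\mathbb Y}$: the vertices of the $n$th level are pairs $(n,\lambda)$ with $\lambda$ a Young diagram with $|\lambda|\le n$ cells, and $(n,\lambda)$, $(n+1,\mu)$ are joined by an edge if $\mu=\lambda$ or $\mu$ is obtained from $\lambda$ by adding one cell. The Pascal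 graph $\mathbb P$ has vertices $(n,k)$, $0\le k\le n$, on level $n$, and $(n,k)$ is joined to $(n+1,k)$ and $(n+1,k+1)$. A probability measure on the space of infinite paths is central if the measure of the cylinder of a finite path from the root depends only on its final vertex $v$ ($F_v$ denotes such a cylinder). Central measures $M$ ergodic with respect to tail equivalence correspond to indecomposable characters $\chi$ of the algebra $A=\bigcup_nA_n$ by $\chi|_{A_n}=\sum_vM(F_v)\chi_v$ (sum over vertices of level $n$, $\chi_v$ the irreducible character of $A_n$ indexed by $v$). For $\delta\in[0,1]$ let $M^\delta_{\mathbb P}$ be the central ergodic measure on $\mathbb P$ concentrated on paths $((f,k_f))_f$ with $\lim k_f/f=\delta$, and let $M_{\mathbb Y}$ correspond to $\chi_{\alpha,\beta}$. Then $\chi_{\alpha,\beta,\delta}$ is the character of $\mathbb{C}[R_\infty]$ corresponding to the central ergodic measure on $\tilde{\mathbb Y}$ with $M(F_{(n,\lambda)})=M_{\mathbb Y}(F_\lambda)\cdot M^\delta_{\mathbb P}(F_{(n,|\lambda|)})$, and $\chi_{\alpha,\beta}$ is called the corresponding character of $\mathbb{C}[S_\infty]$. An element $\sigma\in R_\infty$ is reduced, of order $n(\sigma)\in\{0,1,2,\dots\}$, if all its fixed points are at the end: $\sigma(i)\ne i$ (or $\sigma(i)$ is undefined) for $i\le n(\sigma)$ and $\sigma(i)=i$ for $i>n(\sigma)$; thus $\sigma\in R_{n(\sigma)}$. For $\sigma\in R_n$, $M_k(\sigma)$ is the family, indexed by all $k$-element subsets $K\subset\{1,\dots,n\}$ fixed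 under $\sigma$ (i.e. $K$ lies in the domain of $\sigma$ and $\sigma(K)=K$), of the permutations $\tilde\sigma\in S_n$ that coincide with $\sigma$ on $K$ and are the identity at all other points. In the claim $n=n(\sigma)$.
   Formalization: The printed weight δ^{n(σ)-k}(1-δ)^k is replaced by δ^k(1-δ)^{n(σ)-k}: with lim k_f/f = δ, the nowhere defined σ of order 1 has character value 1-δ, while the printed formula gives δ. *)

(* Defs.v *)
From HB Require Import structures.
From mathcomp Require Import all_boot all_order all_algebra all_fingroup.
From mathcomp Require Import complex.
From mathcomp Require Import all_classical all_reals all_analysis.

Set Implicit Arguments.
Unset Strict Implicit.
Unset Printing Implicit Defensive.

Import Order.TTheory GRing.Theory Num.Theory.
Import numFieldNormedType.Exports.

Local Open Scope classical_set_scope.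
Local Open Scope ring_scope.
Local Open Scope complex_scope.

(* The points 1, ..., n are renumbered 0, ..., n - 1 throughout, and partial
   maps are composed from left to right, like mathcomp permutations. *)

Definition pinj n (f : {ffun 'I_n -> option 'I_n}) : bool :=
  [forall i, forall j, f i && (f i == f j) ==> (i == j)].

Record rook n := Rook { rook_fun : {ffun 'I_n -> option 'I_n};
                        rook_pinj : pinj rook_fun }.

HB.instance Definition _ n := [isSub for @rook_fun n].
HB.instance Definition _ n := [Finite of rook n by <:].

Definition app n (s : rook n) : 'I_n -> option 'I_n := rook_fun s.
Coercion app : rook >-> Funclass.

Lemma rook_inj n (s : rook n) i j k : s i = Some k -> s j = Some k -> i = j.
Proof.
move=> si sj; have /forallP /(_ i) /forallP /(_ j) := rook_pinj s.
by rewrite /app in si sj *; rewrite si sj eqxx /= => /eqP.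
Qed.

Lemma pinjP n (f : {ffun 'I_n -> option 'I_n}) :
  (forall i j k, f i = Some k -> f j = Some k -> i = j) -> pinj f.
Proof.
move=> fI; apply/forallP => i; apply/forallP => j; apply/implyP => /andP[].
by case fi: (f i) => [k|] // _ /eqP fj; apply/eqP/(fI _ _ k).
Qed.

Lemma rookP n (s t : rook n) : s =1 t -> s = t.
Proof. by move=> st; apply/val_inj/ffunP. Qed.

Lemma rook_one_proof n : pinj [ffun i : 'I_n => Some i].
Proof. by apply: pinjP => i j k; rewrite !ffunE => -[->] [->]. Qed.

Lemma rook_mul_proof n (s t : rook n) : pinj [ffun i => obind t (s i)].
Proof.
apply: pinjP => i j k; rewrite !ffunE.
case si: (s i) => [a|] //= ta; case sj: (s j) => [b|] //= tb.
by apply: (rook_inj si); rewrite (rook_inj ta tb).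
Qed.

Definition rook_one n : rook n := Rook (rook_one_proof n).
Definition rook_mul n (s t : rook n) : rook n := Rook (rook_mul_proof s t).

Lemma rook_oneE n i : rook_one n i = Some i.
Proof. by rewrite /app ffunE. Qed.

Lemma rook_mulE n (s t : rook n) i : rook_mul s t i = obind t (s i).
Proof. by rewrite {1}/app ffunE. Qed.

Lemma rook_mulA n : associative (@rook_mul n).
Proof.
move=> s t u; apply: rookP => i; rewrite !rook_mulE.
by case: (s i) => [j|] //=; rewrite rook_mulE.
Qed.

Lemma rook_mul1s n : left_id (rook_one n) (@rook_mul n).
Proof. by move=> s; apply: rookP => i; rewrite rook_mulE rook_oneE. Qed.

Lemma rook_muls1 n : right_id (rook_one n) (@rook_mul n).
Proof.
move=> s; apply: rookP => i; rewrite rook_mulE.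
by case: (s i) => [j|] //=; rewrite rook_oneE.
Qed.

HB.instance Definition _ n :=
  isMonoid.Build (rook n) (@rook_mulA n) (@rook_mul1s n) (@rook_muls1 n).

Lemma rook_of_perm_proof n (s : 'S_n) : pinj [ffun i => Some (s i)].
Proof.
by apply: pinjP => i j k; rewrite !ffunE => -[si] [sj]; apply: (@perm_inj _ s); rewrite si sj.
Qed.

Definition rook_of_perm n (s : 'S_n) : rook n := Rook (rook_of_perm_proof s).

Definition rook_incl_fun n (s : rook n) (i : 'I_n.+1) : option 'I_n.+1 :=
  if unlift ord_max i is Some j then omap (lift ord_max) (s j) else Some ord_max.

Lemma rook_incl_proof n (s : rook n) : pinj (finfun (rook_incl_fun s)).
Proof.
apply: pinjP => i j k; rewrite !ffunE /rook_incl_fun.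
case: unliftP => [a ->|->]; case: unliftP => [b ->|->] //.
- case sa: (s a) => [c|] //= /Some_inj <-; case sb: (s b) => [d|] //= /Some_inj /lift_inj dc.
  by rewrite dc in sb; rewrite (rook_inj sa sb).
- by case: (s a) => [c|] //= /Some_inj <- /Some_inj /eqP; rewrite (negbTE (neq_lift _ _)).
- by move=> /Some_inj <-; case: (s b) => [c|] //= /Some_inj /eqP; rewrite eq_sym (negbTE (neq_lift _ _)).
Qed.

Definition rook_incl n (s : rook n) : rook n.+1 := Rook (rook_incl_proof s).
Definition perm_incl n (s : 'S_n) : 'S_n.+1 := lift_perm ord_max ord_max s.

(* R_oo: injectivity forces a map fixing all i >= n to preserve {0, ..., n-1}. *)
Record rook_inf := RookInf {
  rinf_fun :> nat -> option nat;
  rinf_inj : forall i j k, rinf_fun i = Some k -> rinf_fun j = Some k -> i = j;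
  rinf_fin : exists n, forall i, (n <= i)%N -> rinf_fun i = Some i }.

Definition to_inf_fun n (s : rook n) (i : nat) : option nat :=
  if insub i is Some j then omap val (s j) else Some i.

Lemma to_inf_inj n (s : rook n) i j k :
  to_inf_fun s i = Some k -> to_inf_fun s j = Some k -> i = j.
Proof.
rewrite /to_inf_fun; case: insubP => [a _ <-|ni]; case: insubP => [b _ <-|nj].
- case sa: (s a) => [c|] //= -[<-]; case sb: (s b) => [d|] //= /Some_inj /val_inj dc.
  by rewrite dc in sb; rewrite (rook_inj sa sb).
- by case: (s a) => [c|] //= -[<-] -[je]; rewrite je ltn_ord in nj.
- by move=> -[ie]; case: (s b) => [c|] //= -[ce]; rewrite ie -ce ltn_ord in ni.
- by move=> -[->] -[->].
Qed.

Lemma to_inf_fin n (s : rook n) :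
  exists m, forall i, (m <= i)%N -> to_inf_fun s i = Some i.
Proof.
by exists n => i ni; rewrite /to_inf_fun; case: insubP => // a; rewrite ltnNge ni.
Qed.

Definition to_inf n (s : rook n) : rook_inf :=
  RookInf (@to_inf_inj n s) (to_inf_fin s).

Definition reduced (sigma : rook_inf) (n : nat) : Prop :=
  (forall i, (i < n)%N -> sigma i <> Some i) /\
  (forall i, (n <= i)%N -> sigma i = Some i).

Lemma reduced_rook (sigma : rook_inf) (n : nat) :
  reduced sigma n -> exists s : rook n, to_inf s = sigma.
Proof.
move=> [_ fixs].
have lt_n i k : (i < n)%N -> sigma i = Some k -> (k < n)%N.
  move=> i_n ik; rewrite ltnNge; apply/negP => /[dup] nk /fixs kk.
  by move: i_n; rewrite (rinf_inj ik kk) ltnNge nk.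
have sI : pinj [ffun i : 'I_n => obind insub (sigma i) : option 'I_n].
  apply: pinjP => i j k; rewrite !ffunE.
  case si: (sigma i) => [a|] //=; case: insubP => // u _ ua [uk].
  case sj: (sigma j) => [b|] //=; case: insubP => // v _ vb [vk].
  by apply/val_inj/(rinf_inj si); rewrite sj -ua -vb uk vk.
exists (Rook sI).
have E : to_inf_fun (Rook sI) = sigma.
  apply/funext => i; rewrite /to_inf_fun /app /=.
  case: insubP => [u i_n <-|]; last by rewrite -leqNgt => /fixs ->.
  rewrite ffunE; case su: (sigma u) => [a|] //=.
  by case: insubP => [v _ <-|] //; rewrite (lt_n _ _ (ltn_ord u) su).
case: sigma {fixs lt_n} sI E => f fI fF sI /= E.
rewrite /to_inf; move: (@to_inf_inj _ _) (to_inf_fin _); rewrite E => fI' fF'.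
by congr RookInf; exact: Prop_irrelevance.
Qed.

(* M_k(sigma) is the family (tilde s K), K ranging over fixed_sets s k. *)
Definition fixed_sets n (s : rook n) (k : nat) : {set {set 'I_n}} :=
  [set K : {set 'I_n} | (#|K| == k) && (s @: K == Some @: K)].

(* The default 1 of insubd is not used when K is fixed under s. *)
Definition tilde n (s : rook n) (K : {set 'I_n}) : 'S_n :=
  insubd (1%g : 'S_n) [ffun i => if i \in K then odflt i (s i) else i].

Section IrreducibleCharacters.
Variables (C : fieldType) (G : monoidType).

Definition monoid_rep d (rho : G -> 'M[C]_d) : Prop :=
  rho 1%g = 1%:M /\ forall x y, rho (x * y)%g = rho x *m rho y.

Definition irreducible_rep d (rho : G -> 'M[C]_d) : Prop :=
  [/\ monoid_rep rho, (0 < d)%N &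
      forall U : 'M[C]_d, (forall x, stablemx U (rho x)) ->
        U != 0 -> row_full U].

Definition irreducible_char (f : G -> C) : Prop :=
  exists d (rho : G -> 'M[C]_d),
    irreducible_rep rho /\ forall x, f x = \tr (rho x).

End IrreducibleCharacters.

Record graded_graph := GradedGraph {
  gvertex :> nat -> finType;
  groot : gvertex 0;
  gedge : forall n, gvertex n -> gvertex n.+1 -> bool;
  groot_uniq : forall v : gvertex 0, v = groot;
  gsucc : forall n (v : gvertex n), exists w, gedge v w }.
Arguments gedge {_ n}.

(* The partition of n is padded with zeros to n parts. *)
Record part n := Part { part_val : n.-tuple 'I_n.+1;
  part_valP : sorted geq (map val part_val) && (sumn (map val part_val) == n) }.

HB.instance Definition _ n := [isSub for @part_val n].
HB.instance Definition _ n := [Finite of part n by <:].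

Definition rows n (l : part n) : seq nat := map val (part_val l).

(* For |mu| = |lambda| + 1, mu is lambda plus a cell iff it contains lambda. *)
Definition contained m n (l : part m) (mu : part n) : bool :=
  [forall i : 'I_m, (nth 0 (rows l) i <= nth 0 (rows mu) i)%N].

Lemma rows_eq n (l l' : part n) : rows l = rows l' -> l = l'.
Proof. by move=> ll'; apply/val_inj/val_inj/(inj_map val_inj). Qed.

Lemma part_of_rows n (r : seq nat) :
    sorted geq r -> size r = n -> sumn r = n ->
  exists l : part n, rows l = r.
Proof.
move=> r_sorted r_size r_sum.
have r_lt : all (fun i => i < n.+1)%N r.
  apply/allP => i ir; rewrite ltnS -r_sum; move: ir; elim: r {r_sorted r_size r_sum} => //= a r IH.
  by rewrite inE => /orP[/eqP ->|/IH ir]; rewrite ?leq_addr // (leq_trans ir) ?leq_addl.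
have E : map val (map (@inord n) r) = r.
  rewrite -map_comp -[RHS]map_id; apply/eq_in_map => i ir /=.
  by rewrite inordK //; exact: (allP r_lt).
have sz : size (map (@inord n) r) == n by rewrite size_map r_size.
have lP : sorted geq (map val (Tuple sz)) && (sumn (map val (Tuple sz)) == n).
  by rewrite /= E r_sorted r_sum eqxx.
by exists (Part lP); rewrite /rows /= E.
Qed.

Lemma size_rows n (l : part n) : size (rows l) = n.
Proof. by rewrite size_map size_tuple. Qed.

Lemma part0_exists : exists l : part 0, rows l = [::].
Proof. exact: part_of_rows. Qed.

Definition part0 : part 0 := sval (cid part0_exists).

Lemma part0_uniq (l : part 0) : l = part0.
Proof. by apply: rows_eq; rewrite !(size0nil (size_rows _)). Qed.

Lemma contained_succ n (l : part n) : exists mu : part n.+1, contained l mu.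
Proof.
pose r := mkseq (fun i => nth 0 (rows l) i + (i == 0))%N n.+1.
have [mu muE] : exists mu : part n.+1, rows mu = r.
  have /andP[l_sorted /eqP l_sum] := part_valP l.
  apply: part_of_rows; last first.
  - rewrite sumnE big_map -[iota 0 n.+1]/(index_iota 0 n.+1) big_split /=.
    rewrite big_nat_recr //= nth_default ?size_rows // addn0.
    have -> : (\sum_(0 <= i < n.+1) (i == 0) = 1)%N by rewrite big_nat_recl ?big1.
    have -> : (\sum_(0 <= i < n) nth 0 (rows l) i = n)%N; last by rewrite addn1.
    transitivity (sumn (rows l)); last exact: l_sum.
    by rewrite sumnE [RHS](big_nth 0%N) size_rows.
  - by rewrite size_mkseq.
  apply/(sortedP 0%N) => i; rewrite size_mkseq => i_n.
  rewrite !nth_mkseq //; last exact: ltnW.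
  rewrite /= addn0 (@leq_trans (nth 0%N (rows l) i)) ?leq_addr //.
  have [il|il] := ltnP i.+1 (size (rows l)); last by rewrite nth_default.
  by have /(sortedP 0%N) := l_sorted; apply.
exists mu; apply/forallP => i; rewrite muE nth_mkseq ?leq_addr //.
by rewrite ltnS ltnW.
Qed.

Definition young : graded_graph :=
  GradedGraph (gedge := fun n (l : part n) (mu : part n.+1) => contained l mu)
    part0_uniq contained_succ.

(* A vertex Tagged l of level n is the pair (n, l), and its tag is |l|. *)
Definition slow_vertex (n : nat) : finType := {k : 'I_n.+1 & part k}.

Definition slow_edge n (v : slow_vertex n) (w : slow_vertex n.+1) : bool :=
  (rows (tagged w) == rows (tagged v)) ||
  (tag w == (tag v).+1 :> nat) && contained (tagged v) (tagged w).

Definition slow_root : slow_vertex 0 :=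
  Tagged (fun k : 'I_1 => part k) (part0 : part (@ord0 0)).

Lemma slow_root_uniq (v : slow_vertex 0) : v = slow_root.
Proof. by case: v => k l; rewrite (ord1 k) in l *; rewrite (part0_uniq l). Qed.

Lemma slow_succ n (v : slow_vertex n) : exists w, slow_edge v w.
Proof.
case: v => k l.
pose w : slow_vertex n.+1 :=
  Tagged (fun j : 'I_n.+2 => part j) (l : part (widen_ord (leqnSn _) k)).
by exists w; rewrite /slow_edge /= eqxx.
Qed.

Definition slow_young : graded_graph :=
  GradedGraph (gedge := slow_edge) slow_root_uniq slow_succ.

Definition pascal_edge n (k : 'I_n.+1) (j : 'I_n.+2) : bool :=
  (j == k :> nat) || (j == k.+1 :> nat).

Lemma pascal_root_uniq (k : 'I_1) : k = ord0.
Proof. exact: ord1. Qed.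

Lemma pascal_succ n (k : 'I_n.+1) : exists j, pascal_edge k j.
Proof. by exists (widen_ord (leqnSn _) k); rewrite /pascal_edge /= eqxx. Qed.

Definition pascal : graded_graph :=
  GradedGraph (gvertex := fun n => 'I_n.+1) (gedge := pascal_edge)
    pascal_root_uniq pascal_succ.

Section Paths.
Variable G : graded_graph.

Record gpath := GPath {
  gpath_at :> forall n, G n;
  gpathP : forall n, gedge (gpath_at n) (gpath_at n.+1) }.

Fixpoint base_path_at n : G n :=
  if n is m.+1 then sval (cid (gsucc (base_path_at m))) else groot G.

Lemma base_pathP n : gedge (base_path_at n) (base_path_at n.+1).
Proof. exact: (svalP (cid (gsucc (base_path_at n)))). Qed.

HB.instance Definition _ := gen_eqMixin gpath.
HB.instance Definition _ := gen_choiceMixin gpath.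
HB.instance Definition _ := isPointed.Build gpath (GPath base_pathP).

(* The cylinder of the finite path (x 0, ..., x n). *)
Definition cylinder (x : gpath) (n : nat) : set gpath :=
  [set y | forall i, (i <= n)%N -> y i = x i].

Definition cylinders : set (set gpath) :=
  [set A | exists x n, A = cylinder x n].

Definition path_space := g_sigma_algebraType cylinders.
HB.instance Definition _ := Measurable.on path_space.

Definition tail_equiv (x y : path_space) : Prop :=
  exists N, forall n, (N <= n)%N -> x n = y n.

Section Measures.
Variables (R : realType) (M : probability path_space R).

Definition central : Prop :=
  forall n (x y : path_space), x n = y n -> M (cylinder x n) = M (cylinder y n).

Definition ergodic : Prop :=
  forall E : set path_space, measurable E ->
    (forall x y, tail_equiv x y -> E x -> E y) -> M E = 0%E \/ M E = 1%E.

(* M(F_v), through an arbitrarily chosen path to v *)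
Definition cyl_weight n (v : G n) : R :=
  fine (M (cylinder (xget point [set x : path_space | x n = v]) n)).

End Measures.
End Paths.

Section Characters.
Variable R : realType.
Local Notation C := R[i].

(* chi identifies G with the branching graph of A_0 < A_1 < ... : it labels the
   irreducible characters of A_n by the vertices of level n, and restriction
   from A_(n+1) to A_n follows the edges (all multiplicities are 1). *)
Record branching (G : graded_graph) (A : nat -> monoidType)
    (incl : forall n, A n -> A n.+1) (chi : forall n, G n -> A n -> C) : Prop :=
  { branching_irr : forall n (v : G n), irreducible_char (chi n v);
    branching_inj : forall n (v w : G n), chi n v =1 chi n w -> v = w;
    branching_surj : forall n (f : A n -> C), irreducible_char f ->
      exists v, chi n v =1 f;
    branching_restr : forall n (w : G n.+1) (a : A n),
      chi n.+1 w (incl n a) = \sum_(v : G n | gedge v w) chi n v a }.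

(* The transposition of diagrams is an automorphism of both graphs; it is ruled
   out by giving the one-row diagrams to the trivial characters of S_n, and
   lambda and (n, lambda), for |lambda| = n, to the same character of S_n. *)
Record standard_indexing (chiS : forall n, young n -> 'S_n -> C)
    (chiR : forall n, slow_young n -> rook n -> C) : Prop :=
  { indexing_S : branching perm_incl chiS;
    indexing_R : branching rook_incl chiR;
    indexing_row : forall n (l : young n) (s : 'S_n),
      nth 0%N (rows l) 1 = 0%N -> chiS n l s = 1;
    indexing_SR : forall n (l : young n) (s : 'S_n),
      chiR n (Tagged (fun k : 'I_n.+1 => part k) (l : part (@ord_max n)))
        (rook_of_perm s) = chiS n l s }.

(* f n is the restriction to A_n of the character given by M. *)
Definition corresponds (G : graded_graph) (A : nat -> monoidType)
    (chi : forall n, G n -> A n -> C) (M : probability (path_space G) R)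
    (f : forall n, A n -> C) : Prop :=
  forall n (a : A n), f n a = \sum_(v : G n) (cyl_weight M v)%:C * chi n v a.

Record thoma_parameters (alpha beta : nat -> R) : Prop :=
  { alpha_ge0 : forall i, 0 <= alpha i;
    beta_ge0 : forall i, 0 <= beta i;
    alpha_noninc : nonincreasing_seq alpha;
    beta_noninc : nonincreasing_seq beta;
    alpha_beta_le1 : (\sum_(0 <= i <oo) (alpha i)%:E +
                      \sum_(0 <= i <oo) (beta i)%:E <= 1)%E }.

Definition power_sum (a : nat -> R) (m : nat) : R :=
  limn (series (fun i => a i ^+ m)).

(* Thoma's formula for chi_(alpha, beta): a product over the nontrivial cycles,
   hence compatible with the inclusions of S_n in S_(n+1). *)
Definition thoma_char (alpha beta : nat -> R) n (s : 'S_n) : C :=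
  (\prod_(X in porbits s | (1 < #|X|)%N)
    (power_sum alpha #|X| + (- 1) ^+ #|X|.-1 * power_sum beta #|X|))%:C.

Definition central_ergodic (G : graded_graph)
    (M : probability (path_space G) R) : Prop := central M /\ ergodic M.

Definition pascal_measure (delta : R) (M : probability (path_space pascal) R)
    : Prop :=
  central_ergodic M /\
  {ae M, forall x : path_space pascal,
     (fun f : nat => (x f : 'I_f.+1)%:R / f%:R : R) @ \oo --> delta}.

Definition young_measure (chiS : forall n, young n -> 'S_n -> C)
    (alpha beta : nat -> R) (M : probability (path_space young) R) : Prop :=
  central_ergodic M /\ corresponds chiS M (thoma_char alpha beta).

(* chi is chi_(alpha, beta, delta). As delta is the limit of k_f / f, a vertex
   (n, lambda) carries the Pascal weight delta^|lambda| (1 - delta)^(n - |lambda|):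
   delta = 1 gives chi_(alpha, beta) extended by 0 outside S_oo, and delta = 0
   gives the trivial character. So in the value at sigma a fixed set K has the
   weight delta^|K| (1 - delta)^(n - |K|); the version in print, with delta and
   1 - delta interchanged, goes with k_f / f --> 1 - delta. *)
Definition rook_character (chiS : forall n, young n -> 'S_n -> C)
    (chiR : forall n, slow_young n -> rook n -> C)
    (alpha beta : nat -> R) (delta : R) (chi : rook_inf -> C) : Prop :=
  exists (MY : probability (path_space young) R)
         (MP : probability (path_space pascal) R)
         (M : probability (path_space slow_young) R),
    [/\ young_measure chiS alpha beta MY,
        pascal_measure delta MP,
        central_ergodic M,
        forall n (v : slow_young n),
          cyl_weight M v = cyl_weight MY (tagged v : young (tag v)) *
                           cyl_weight MP (tag v : pascal n)
      & corresponds chiR M (fun n s => chi (to_inf s))].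

End Characters.

(* Main.v *)
(* An irreducible representation of R_n has an apex k: it kills the elements of
   rank < k, and the sum of the idempotents e_K with |K| = k acts as the
   identity, so that its character is
     chi(s) = \sum_(K fixed under s, |K| = k) chi(e_K s),
   where chi(e_K s) depends only on the conjugacy class in S_k of s on K. By
   induction along the branching graph, the character labelled (n, lambda) has
   apex |lambda|, and its value at an element that acts as p on a k-element set
   and is undefined elsewhere is chi_lambda(p): if p has a fixed point, evaluate at
   an element of R_(n-1) of rank k - 1, otherwise at one of rank k. At
   level 1 the two characters of R_1 are told apart by looking at level 2.

   On the Pascal graph, centrality makes all steps after a path exchangeable.
   Integrating k_f / f over a cylinder ending at (n, k) and passing to the limit
   gives M(n + 1, k + 1) = delta M(n, k), hence
   M(n, k) = delta^k (1 - delta)^(n - k). The theorem follows by summing over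
   lambda for every fixed set K separately. *)
Require Import Defs.
From mathcomp Require Import all_boot all_order all_algebra all_fingroup.
From mathcomp Require Import ring zify complex.
From mathcomp Require Import all_classical all_reals all_analysis.

Set Implicit Arguments.
Unset Strict Implicit.
Unset Printing Implicit Defensive.

Import Order.TTheory GRing.Theory Num.Theory.

Local Open Scope ring_scope.
Local Open Scope complex_scope.

(** * Irreducible characters of R_n *)

Section RookMonoid.
Import mathcomp.boot.fintype mathcomp.boot.finset.

Definition rook_im n (s : rook n) : {set 'I_n} :=
  [set j | [exists i, s i == Some j]].

Lemma rook_imP n (s : rook n) j :
  reflect (exists i, s i = Some j) (j \in rook_im s).
Proof.
by rewrite inE; apply: (iffP existsP) => -[i /eqP]; exists i => //; apply/eqP.
Qed.

Lemma rook_id_proof n (K : {set 'I_n}) :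
  pinj [ffun i => if i \in K then Some i else None].
Proof.
by apply: pinjP => i j k; rewrite !ffunE; do 2!case: ifP => // _; move=> [->] [->].
Qed.

Definition rook_id n (K : {set 'I_n}) : rook n := Rook (rook_id_proof K).

Lemma rook_idE n (K : {set 'I_n}) i :
  rook_id K i = if i \in K then Some i else None.
Proof. by rewrite /app ffunE. Qed.

Lemma rookME n (s t : rook n) i : (s * t)%g i = obind t (s i).
Proof. exact: rook_mulE. Qed.

Lemma rook1E n i : (1%g : rook n) i = Some i.
Proof. exact: rook_oneE. Qed.

Lemma rook_id_mulE n (K : {set 'I_n}) (s : rook n) i :
  (rook_id K * s)%g i = if i \in K then s i else None.
Proof. by rewrite rookME rook_idE; case: ifP. Qed.

Lemma rook_idI n (K L : {set 'I_n}) : (rook_id K * rook_id L)%g = rook_id (K :&: L).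
Proof.
by apply: rookP => i; rewrite rook_id_mulE !rook_idE inE; case: (i \in K).
Qed.

Lemma rook_idT n : rook_id [set: 'I_n] = 1%g.
Proof. by apply: rookP => i; rewrite rook_idE inE rook1E. Qed.

Lemma mul_rook_im n (s : rook n) : (s * rook_id (rook_im s))%g = s.
Proof.
apply: rookP => i; rewrite rookME; case si: (s i) => [j|] //=; rewrite rook_idE.
by case: rook_imP => // -[]; exists i.
Qed.

Lemma rook_im_mul_id n (s : rook n) K : rook_im (s * rook_id K)%g = rook_im s :&: K.
Proof.
apply/setP => j; rewrite [RHS]inE; apply/rook_imP/andP => [[a]|[/rook_imP [i si] jK]].
  rewrite rookME; case si: (s a) => [b|] //=; rewrite rook_idE.
  by case: ifP => // bK [<-]; split=> //; apply/rook_imP; exists a.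
by exists i; rewrite rookME si /= rook_idE jK.
Qed.

Lemma sub_im_imset n (s : rook n) (K : {set 'I_n}) :
  Some @: rook_im (rook_id K * s)%g \subset s @: K.
Proof.
apply/subsetP => _ /imsetP [j /rook_imP [i ij] ->]; move: ij.
by rewrite rook_id_mulE; case: ifP => // iK <-; apply: imset_f.
Qed.

Lemma card_im_id n (s : rook n) (K : {set 'I_n}) :
  (#|rook_im (rook_id K * s)%g| <= #|K|)%N.
Proof.
rewrite -(card_imset _ Some_inj) (leq_trans (subset_leq_card (sub_im_imset s K))) //.
exact: leq_imset_card.
Qed.

Lemma fixed_sets_id n (K : {set 'I_n}) k :
  fixed_sets (rook_id K) k = [set L : {set 'I_n} | L \subset K & #|L| == k].
Proof.
apply/setP => L; rewrite !inE andbC; congr (_ && _); apply/eqP/subsetP => [LL i iL|LK].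
  have : Some i \in rook_id K @: L by rewrite LL imset_f.
  by case/imsetP => j jL; rewrite rook_idE; case: ifP => // jK [->].
by apply: eq_in_imset => i /LK iK; rewrite rook_idE iK.
Qed.

(* [k] is the rank of the J-class at which the representation lives. *)
Definition has_apex (C : numFieldType) n (f : rook n -> C) (k : nat) : Prop :=
  [/\ (k <= n)%N,
      forall s, (#|rook_im s| < k)%N -> f s = 0,
      forall s, f s = \sum_(K in fixed_sets s k) f (rook_id K * s)%g,
      k = 0%N -> forall s, f s = 1 &
      exists2 c, 0 < c & forall K : {set 'I_n}, f (rook_id K) = c *+ 'C(#|K|, k)].

Lemma irreducible_charC (C : fieldType) (G : monoidType) (f : G -> C) x y :
  irreducible_char f -> f (x * y)%g = f (y * x)%g.
Proof.
by case=> d [rho [[[_ rhoM] _ _] fE]]; rewrite !fE !rhoM mxtrace_mulC.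
Qed.

Lemma irreducible_char1 (C : fieldType) (G : monoidType) (f : G -> C) :
  irreducible_char f -> exists2 d, (0 < d)%N & f 1%g = d%:R.
Proof.
case=> d [rho [[[rho1 _] d_gt0 _] fE]]; exists d => //.
by rewrite fE rho1 mxtrace1.
Qed.

(** * Elements acting as a permutation on an embedded [k]-element set *)

Section Transfer.
Variables (n k : nat).
Implicit Types (t u : 'I_k -> 'I_n) (p q : 'S_k) (x y : rook n).

(** The coordinates [t] are an arbitrary embedding rather than the increasing one, so that
    relabelling them by [q] only conjugates [p]. *)
Definition acts_as x t p : Prop :=
  [/\ injective t, forall i, x (t i) = Some (t (p i)) &
      forall a, (forall i, a <> t i) -> x a = None].

Lemma transfer_exists t u : injective t -> injective u ->
  exists b : rook n, (forall i, b (t i) = Some (u i)) /\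
                     (forall a, (forall i, a <> t i) -> b a = None).
Proof.
move=> tI uI.
pose f := [ffun a => if [pick i | t i == a] is Some i then Some (u i) else None].
have f_inj : pinj f.
  apply: pinjP => a b c; rewrite !ffunE.
  case: pickP => // i /eqP <- [<-]; case: pickP => // j /eqP <- [] /uI ->.
  by [].
exists (Rook f_inj); split=> [i|a ta]; rewrite /app ffunE /=.
  by case: pickP => [j /eqP /tI -> //|/(_ i)]; rewrite eqxx.
by case: pickP => // i /eqP ia; case: (ta i).
Qed.

Lemma acts_as_exists t p : injective t -> exists x, acts_as x t p.
Proof.
move=> tI; have uI : injective (t \o p) by move=> i j /tI /perm_inj.
by have [x [xt x0]] := transfer_exists tI uI; exists x.
Qed.

Lemma acts_as_conj x t p q : acts_as x t p -> acts_as x (t \o q) (q * p * q^-1)%g.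
Proof.
move=> [tI xt x0]; split=> [i j /tI /perm_inj //|i|a ta] /=.
  by rewrite xt !permM permKV.
by apply: x0 => i; have := ta ((q^-1)%g i); rewrite /= permKV.
Qed.

(** If [b] maps [t i] to [u i], [c] maps [u i] to [t (p i)], and both are undefined elsewhere, then
    [x = b * c] and [y = c * b]. *)
Lemma acts_as_class (T : Type) (f : rook n -> T) x y t u p :
    (forall x y, f (x * y)%g = f (y * x)%g) ->
  acts_as x t p -> acts_as y u p -> f x = f y.
Proof.
move=> fC [tI xt x0] [uI yu y0].
have tpI : injective (t \o p) by move=> i j /tI /perm_inj.
have [b [bt b0]] := transfer_exists tI uI.
have [c [cu c0]] := transfer_exists uI tpI.
have -> : x = (b * c)%g.
  apply: rookP => a; rewrite rookME.
  have [[i ->]|ta] := pselect (exists i, a = t i); first by rewrite bt /= cu xt.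
  have {}ta i : a <> t i by move=> ai; apply: ta; exists i.
  by rewrite b0 // x0.
rewrite fC; congr f; apply: rookP => a; rewrite rookME.
have [[i ->]|ua] := pselect (exists i, a = u i); first by rewrite cu /= bt yu.
have {}ua i : a <> u i by move=> ai; apply: ua; exists i.
by rewrite c0 // y0.
Qed.

Lemma card_im_acts_as x t p : acts_as x t p -> (#|rook_im x| <= k)%N.
Proof.
move=> [tI xt x0].
rewrite -[leqRHS]card_ord -(card_imset _ tI) subset_leq_card //.
apply/subsetP => b /rook_imP [a xa].
have [[i ai]|ta] := pselect (exists i, a = t i).
  by move: xa; rewrite ai xt => -[<-]; apply: imset_f.
by rewrite x0 // in xa => i ai; apply: ta; exists i.
Qed.

(** Enumerating [K] turns [s] on [K] into a permutation of ['I_k], through which both sides of the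
    final formula are evaluated. *)
Lemma fixed_set_acts_as (s : rook n) (K : {set 'I_n}) : K \in fixed_sets s k ->
  exists t p, [/\ acts_as (rook_id K * s)%g t p, K = t @: [set: 'I_k] &
               forall i, s (t i) = Some (t (p i))].
Proof.
rewrite inE => /andP[/eqP Kk /eqP sK].
have [t tI tK] : exists2 t : 'I_k -> 'I_n, injective t & K = t @: [set: 'I_k].
  rewrite -Kk; exists enum_val; first exact: enum_val_inj.
  apply/setP => a; apply/idP/imsetP => [aK|[i _ ->]]; last exact: enum_valP.
  by exists (enum_rank_in aK a); rewrite ?inE // enum_rankK_in.
have tinK i : t i \in K by rewrite tK imset_f.
have st i : exists j, s (t i) == Some (t j).
  have : s (t i) \in Some @: K by rewrite -sK imset_f.
  by case/imsetP => a; rewrite tK => /imsetP [j _ ->] ->; exists j.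
pose g i := xchoose (st i).
have gE i : s (t i) = Some (t (g i)) by apply/eqP/(xchooseP (st i)).
have gI : injective g.
  by move=> i j ij; apply/tI/(rook_inj (gE i)); rewrite gE ij.
exists t, (perm gI); split=> // [|i]; last by rewrite permE.
split=> // [i|a ta]; rewrite rook_id_mulE; first by rewrite tinK permE.
by case: ifP => //; rewrite tK => /imsetP [i _ /ta].
Qed.

End Transfer.

(** * The apex of an irreducible character *)

Section Apex.
Variables (C : numFieldType) (n : nat).

Lemma acts_as_rook_id (K : {set 'I_n}) :
  exists t : 'I_#|K| -> 'I_n, acts_as (rook_id K) t 1%g.
Proof.
exists enum_val; split=> [|i|a aK]; first exact: enum_val_inj.
  by rewrite perm1 rook_idE enum_valP.
rewrite rook_idE; case: ifP => // aK'; case: (aK (enum_rank_in aK' a)).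
by rewrite enum_rankK_in.
Qed.

(** The apex is the least rank of an idempotent with nonzero image. The sum [S] of the images of all
    idempotents of that rank has a stable row space, so irreducibility forces [S = 1]; the trace of
    [S *m rho s] then gives the expansion over fixed sets. *)
Lemma irreducible_char_apex (f : rook n -> C) :
  irreducible_char f -> exists k, has_apex f k.
Proof.
move=> fi; have fC x y : f (x * y)%g = f (y * x)%g by exact: irreducible_charC.
have [dd dd_gt0 f1] := irreducible_char1 fi.
case: (fi) => d [rho [[[rho1 rhoM] d_gt0 irr] fE]].
pose E K := rho (rook_id K).
have one_neq0 : (1%:M : 'M[C]_d) != 0.
  by rewrite -mxrank_eq0 mxrank1 -lt0n.
have ET : E [set: 'I_n] != 0 by rewrite /E rook_idT rho1.
pose K0 := [arg min_(K < [set: 'I_n] | E K != 0) #|K|].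
have [EK0 K0min] : E K0 != 0 /\ forall K, E K != 0 -> (#|K0| <= #|K|)%N.
  by rewrite /K0; case: arg_minnP.
have [k K0k] : exists k, #|K0| = k by exists #|K0|.
rewrite K0k in K0min.
have im0 s : (#|rook_im s| < k)%N -> rho s = 0.
  move=> sk; rewrite -(mul_rook_im s) rhoM.
  suff /eqP-> : rho (rook_id (rook_im s)) == 0 by rewrite mulmx0.
  by apply: contraLR sk => /K0min; rewrite leqNgt.
pose S := \sum_(K : {set 'I_n} | #|K| == k) E K.
(* In rank [k] only the term with [K] the image of [x] survives: any other [x * rook_id K] has rank
   below [k]. *)
have mulS x : (#|rook_im x| <= k)%N -> rho x *m S = rho x.
  rewrite leq_eqVlt => /orP[/eqP xk|/im0->]; last by rewrite mul0mx.
  rewrite mulmx_sumr (bigD1 (rook_im x)) /= ?xk // -rhoM mul_rook_im.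
  rewrite big1 ?addr0 // => K /andP[/eqP Kk KimN]; rewrite -rhoM im0 // rook_im_mul_id.
  rewrite ltn_neqAle -{2}xk subset_leq_card ?subsetIl // andbT.
  apply: contra KimN => /eqP IK; apply/eqP.
  have IK1 : rook_im x :&: K = K by apply/eqP; rewrite eqEcard subsetIr IK Kk /=.
  have IK2 : rook_im x :&: K = rook_im x.
    by apply/eqP; rewrite eqEcard subsetIl IK xk /=.
  by rewrite -IK1 IK2.
(* Each [rook_id K * s] has rank at most [k], so it absorbs [S]. This makes the row space of [S]
   stable and, at [s = 1], makes [S] idempotent. *)
have SrhoS s : S *m rho s *m S = S *m rho s.
  rewrite !mulmx_suml; apply: eq_bigr => K /eqP Kk.
  by rewrite -rhoM mulS // -Kk card_im_id.
have Sne0 : S != 0.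
  apply: contra EK0 => /eqP S0.
  rewrite /E -(mulS (rook_id K0)) ?S0 ?mulmx0 //.
  by rewrite -(mul1g (rook_id K0)) -[X in (X * _)%g]rook_idT rook_idI
    setTI -(setIid K0) -rook_idI -K0k card_im_id.
have Sfull : row_full S.
  by apply: irr => // s; rewrite -SrhoS submxMl.
have S1 : S = 1%:M.
  have := SrhoS 1%g; rewrite rho1 mulmx1 => SS.
  have Su : S \in unitmx by rewrite -row_full_unit.
  by rewrite -[LHS](mulmxK Su) SS mulmxV.
have expand s : f s = \sum_(K in fixed_sets s k) f (rook_id K * s)%g.
  (* By cyclicity of the trace a second factor [rook_id K] may be added on the right; the rank then
     drops below [k] unless [s] maps [K] onto itself. *)
  have trK K : \tr (E K *m rho s) = f (rook_id K * s * rook_id K)%g.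
    by rewrite fC mulgA rook_idI setIid fE rhoM.
  rewrite fE -[rho s]mul1mx -S1 mulmx_suml raddf_sum /=.
  rewrite (bigID (fun K => K \in fixed_sets s k)) /=
    [X in _ + X]big1 ?addr0; last first.
    move=> K /andP[/eqP Kk]; rewrite inE Kk eqxx /= => sK.
    rewrite trK fE im0 ?mxtrace0 // rook_im_mul_id ltn_neqAle -{2}Kk.
    rewrite subset_leq_card ?subsetIr // andbT; apply: contra sK => /eqP IK.
    have IK2 : rook_im (rook_id K * s)%g :&: K = K.
      by apply/eqP; rewrite eqEcard subsetIr IK Kk /=.
    rewrite eq_sym eqEcard (card_imset _ Some_inj) leq_imset_card andbT.
    apply: subset_trans (sub_im_imset s K); rewrite imsetS //.
    by rewrite -{1}IK2 subsetIl.
  apply: eq_big => [K|K _]; last by rewrite fE rhoM.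
  by rewrite inE; case: (#|K| == k).
have kn : (k <= n)%N by rewrite -K0k -[leqRHS]card_ord max_card.
have [c fid] : exists c, forall K : {set 'I_n}, #|K| = k -> f (rook_id K) = c.
  exists (f (rook_id K0)) => K Kk.
  have [t xt] := acts_as_rook_id K; have [u xu] := acts_as_rook_id K0.
  by rewrite K0k -Kk in u xu; exact: (acts_as_class fC xt xu).
have fidC K : f (rook_id K) = c *+ 'C(#|K|, k).
  rewrite expand fixed_sets_id -cards_draws -sumr_const; apply: eq_bigr => L.
  by rewrite inE => /andP[/setIidPl LK /eqP Lk]; rewrite rook_idI LK fid.
exists k; split=> // [s sk|k0 s|].
- by rewrite fE im0 ?mxtrace0.
(* For [k = 0] the zero [rook_id set0] of the monoid acts as [S = 1] and absorbs every [x]; so [rho]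
   is trivial, and irreducibility gives [d = 1]. *)
- have rho1' x : rho x = 1%:M.
    have K00 : K0 = set0 by apply/eqP; rewrite -cards_eq0 K0k k0.
    have E0 : E set0 = 1%:M.
      by rewrite -S1 /S (bigD1 set0) /= ?cards0 ?k0 //
        big1 ?addr0 // => K; rewrite cards_eq0 => /andP[->].
    rewrite -[LHS]mulmx1 -E0 -rhoM.
    have -> : (x * rook_id set0)%g = rook_id set0; last by [].
    apply: rookP => i; rewrite rookME rook_idE inE; case: (x i) => //= a.
    by rewrite rook_idE inE.
  have d1 : d = 1%N.
    pose i0 := Ordinal d_gt0.
    have /eqP : row_full (delta_mx i0 i0 : 'M[C]_d).
      apply: irr => [x|]; first by rewrite rho1' mulmx1.
      by rewrite -mxrank_eq0 mxrank_delta.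
    by rewrite mxrank_delta.
  by rewrite fE rho1' mxtrace1 d1.
exists c => //.
(* The value at the identity is both [c *+ 'C(n, k)] and a positive dimension. *)
have := fidC [set: 'I_n]; rewrite rook_idT cardsT card_ord f1 => ddE.
have : 0 < dd%:R :> C by rewrite ltr0n.
by rewrite ddE pmulrn_lgt0 // bin_gt0.
Qed.

End Apex.

End RookMonoid.

(** * The slow Young graph *)

Section Inclusion.
Import mathcomp.boot.fintype mathcomp.boot.finset.

Lemma rook_incl_lift n (s : rook n) j :
  rook_incl s (lift ord_max j) = omap (lift ord_max) (s j).
Proof. by rewrite {1}/app ffunE /rook_incl_fun liftK. Qed.

Lemma rook_incl_max n (s : rook n) : rook_incl s ord_max = Some ord_max.
Proof. by rewrite {1}/app ffunE /rook_incl_fun unlift_none. Qed.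

Lemma rook_incl1 n : rook_incl (1%g : rook n) = 1%g.
Proof.
apply: rookP => i; rewrite rook1E; case: (unliftP ord_max i) => [j ->|->].
  by rewrite rook_incl_lift rook1E.
by rewrite rook_incl_max.
Qed.

Lemma perm_incl1 n : perm_incl (1%g : 'S_n) = 1%g.
Proof. exact: lift_perm1. Qed.

Lemma rook_incl_id n (K : {set 'I_n}) :
  exists2 L : {set 'I_n.+1}, #|L| = #|K|.+1 & rook_incl (rook_id K) = rook_id L.
Proof.
exists (ord_max |: lift ord_max @: K).
  rewrite cardsU1 (card_imset _ lift_inj).
  by case: imsetP => // -[j _ /eqP]; rewrite (negbTE (neq_lift _ _)).
apply: rookP => i; rewrite rook_idE; case: (unliftP ord_max i) => [j ->|->].
  rewrite rook_incl_lift rook_idE in_setU1 (mem_imset _ _ lift_inj).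
  by rewrite eq_sym (negbTE (neq_lift _ _)) /=; case: ifP.
by rewrite rook_incl_max in_setU1 eqxx.
Qed.

Definition extend_max k n (t : 'I_k -> 'I_n) (i : 'I_k.+1) : 'I_n.+1 :=
  if unlift ord_max i is Some j then lift ord_max (t j) else ord_max.

Lemma acts_as_incl k n (x : rook n) (t : 'I_k -> 'I_n) (p : 'S_k) :
  acts_as x t p -> acts_as (rook_incl x) (extend_max t) (perm_incl p).
Proof.
move=> [tI xt x0].
have eL j : extend_max t (lift ord_max j) = lift ord_max (t j).
  by rewrite /extend_max liftK.
have eM : extend_max t ord_max = ord_max by rewrite /extend_max unlift_none.
split=> [i j|i|a ta].
- case: (unliftP ord_max i) => [a ->|->]; case: (unliftP ord_max j) => [b ->|->];
    rewrite ?eL ?eM //.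
  + by move=> /lift_inj /tI ->.
  + by move/eqP; rewrite eq_sym (negbTE (neq_lift _ _)).
  + by move/eqP; rewrite (negbTE (neq_lift _ _)).
- case: (unliftP ord_max i) => [a ->|->].
    by rewrite eL rook_incl_lift xt /perm_incl lift_perm_lift eL.
  by rewrite /perm_incl lift_perm_id eM rook_incl_max.
- case: (unliftP ord_max a) => [b bE|aE]; last by case: (ta ord_max); rewrite eM.
  rewrite bE rook_incl_lift x0 // => i bi.
  by case: (ta (lift ord_max i)); rewrite eL -bi.
Qed.

(** An [m]-element fixed set misses one point [t j] of the domain. If [p j] were not [j], then
    [t (p j)] would lie in [K], while its only preimage [t j] does not. *)
Lemma fixed_sets_acts_as n m (x : rook n) (t : 'I_m.+1 -> 'I_n) (p : 'S_m.+1) K :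
  acts_as x t p -> K \in fixed_sets x m -> exists2 i, p i = i & K = t @: [set~ i].
Proof.
move=> [tI xt x0]; rewrite inE => /andP[/eqP Km /eqP xK].
pose L := t @^-1: K.
have KL : K = t @: L.
  apply/setP => a; apply/idP/imsetP => [aK|[j]]; last by rewrite inE => jL ->.
  have [[j aj]|ta] := pselect (exists j, a = t j).
    by exists j; rewrite // inE -aj.
  have : x a \in Some @: K by rewrite -xK imset_f.
  by rewrite x0 => [/imsetP[]//|j aj]; apply: ta; exists j.
have Lm : #|L| = m by have := Km; rewrite KL card_imset.
have /eqP/cards1P[j CL] : #|~: L| = 1%N.
  by apply: (@addnI m); have := cardsC L; rewrite Lm card_ord addn1.
have LE : L = [set~ j] by rewrite -[L]setCK CL.
exists j; last by rewrite KL LE.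
apply/eqP; apply/idPn => pj.
have : t (p j) \in K by rewrite KL imset_f // LE !inE.
rewrite -(mem_imset _ _ Some_inj) -xK => /imsetP[a]; rewrite KL LE => /imsetP[b bj ->].
by rewrite xt => -[/tI /perm_inj jb]; move: bj; rewrite jb !inE eqxx.
Qed.

Lemma acts_as_fixed_sets n m (x : rook n) (t : 'I_m.+1 -> 'I_n) (p : 'S_m.+1) i :
  acts_as x t p -> p i = i -> t @: [set~ i] \in fixed_sets x m.
Proof.
move=> [tI xt x0] pii; rewrite inE (card_imset _ tI) cardsC1 card_ord eqxx /=.
have pK j : (p j \in [set~ i]) = (j \in [set~ i]).
  by rewrite !inE -{1}pii (inj_eq perm_inj).
apply/eqP/setP => b; apply/imsetP/imsetP => -[_ /imsetP[j ji ->] ->].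
  by rewrite xt; exists (t (p j)); rewrite // imset_f // pK.
exists (t ((p^-1)%g j)); last by rewrite xt permKV.
by rewrite imset_f // -pK permKV.
Qed.

Lemma acts_as_rook_of_perm n (p : 'S_n) : acts_as (rook_of_perm p) id p.
Proof. by split=> // [i|a /(_ a)//]; rewrite /app ffunE. Qed.

(** The transposition of [i] and the last point moves the fixed point to the end. *)
Lemma perm_incl_conj n (p : 'S_n.+1) i :
  p i = i -> exists q (p' : 'S_n), (q * p * q^-1)%g = perm_incl p'.
Proof.
move=> pii; pose q := tperm i ord_max; exists q.
set r := (q * p * q^-1)%g.
have rM : r ord_max = ord_max by rewrite /r /q !permM tpermV tpermR pii tpermL.
have rL j : exists j', r (lift ord_max j) == lift ord_max j'.
  case: (unliftP ord_max (r (lift ord_max j))) => [j' ->|/eqP]; first by exists j'.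
  by rewrite -{2}rM (inj_eq perm_inj) eq_sym (negbTE (neq_lift _ _)).
pose f j := xchoose (rL j).
have fE j : r (lift ord_max j) = lift ord_max (f j) by apply/eqP/(xchooseP (rL j)).
have f_inj : injective f.
  by move=> j1 j2 jj; have := fE j1; rewrite jj -fE => /perm_inj /lift_inj.
exists (perm f_inj); apply/permP => j; case: (unliftP ord_max j) => [a ->|->].
  by rewrite fE /perm_incl lift_perm_lift permE.
by rewrite /perm_incl lift_perm_id.
Qed.

Lemma widen_ord_injective m n (mn : (m <= n)%N) : injective (widen_ord mn).
Proof. by move=> i j /(congr1 val) /= /val_inj. Qed.

Lemma ord_set_card n j : (j <= n)%N -> exists K : {set 'I_n}, #|K| = j.
Proof.
move=> jn; exists (widen_ord jn @: [set: 'I_j]).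
by rewrite card_imset ?cardsT ?card_ord //; exact: widen_ord_injective.
Qed.

End Inclusion.

(** * Sums over the lower neighbours of a vertex *)

Section SlowYoung.

(** Separating the size from its bound lets the same [l : part k] be placed on every level
    [n >= k]. *)
Definition slow_vtx n k (kn : (k < n.+1)%N) (l : part k) : slow_vertex n :=
  Tagged (fun k : 'I_n.+1 => part k) (l : part (Ordinal kn)).

Lemma slow_vtxP n (P : slow_vertex n -> Prop) :
  (forall k (kn : (k < n.+1)%N) (l : part k), P (slow_vtx kn l)) -> forall v, P v.
Proof. by move=> Pv [[k kn] l]; exact: Pv. Qed.

Lemma slow_edge_tag n (v : slow_vertex n) (w : slow_vertex n.+1) :
  slow_edge v w -> tag w = tag v :> nat \/ tag w = (tag v).+1 :> nat.
Proof.
case/orP => [/eqP /(congr1 size)|/andP[/eqP]]; last by right.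
by rewrite !size_rows; left.
Qed.

Lemma slow_edge_eq n k (kn : (k < n.+1)%N) (kn' : (k < n.+2)%N) (l l' : part k) :
  slow_edge (slow_vtx kn l) (slow_vtx kn' l') = (l == l').
Proof.
rewrite /slow_edge /= (ltn_eqF (ltnSn k)) orbF eq_sym.
by apply/eqP/eqP => [/rows_eq->|->].
Qed.

Lemma slow_edge_succ n k (kn : (k < n.+1)%N) (kn' : (k.+1 < n.+2)%N)
    (l : part k) (l' : part k.+1) :
  slow_edge (slow_vtx kn l) (slow_vtx kn' l') = contained l l'.
Proof.
rewrite /slow_edge /= eqxx /= orb_idl // => /eqP /(congr1 size).
by rewrite !size_rows => /eqP; rewrite (gtn_eqF (ltnSn k)).
Qed.

Variable V : nmodType.

Lemma sum_slow_level n k (kn : (k < n.+1)%N) (Q : pred (slow_vertex n))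
    (F : slow_vertex n -> V) :
  \sum_(v : slow_vertex n | (tag v == k :> nat) && Q v) F v =
  \sum_(l : part k | Q (slow_vtx kn l)) F (slow_vtx kn l).
Proof.
pose F' i := \sum_(l : part (i : 'I_n.+1) | Q (Tagged _ l)) F (Tagged _ l).
transitivity (\sum_(i | i == Ordinal kn) F' i); last by rewrite big_pred1_eq.
by rewrite sig_big_dep; apply: eq_big => -[[j jn] l].
Qed.

(** First of three cases. For [0 < |l| <= n] the lower neighbours are [l] and the diagrams [l] minus
    a cell; for [|l| = n.+1] the vertex [l] itself drops out, and for the empty [l] it is the only
    one. *)
Lemma sum_slow_edge_lt n k (kn : (k.+1 < n.+1)%N) (kn0 : (k < n.+1)%N)
    (kn1 : (k.+1 < n.+2)%N) (l : part k.+1) (F : slow_vertex n -> V) :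
  \sum_(v | slow_edge v (slow_vtx kn1 l)) F v =
  F (slow_vtx kn l) + \sum_(m : part k | contained m l) F (slow_vtx kn0 m).
Proof.
rewrite (bigID (fun v : slow_vertex n => tag v == k.+1 :> nat)) /=; congr (_ + _).
  under eq_bigl do rewrite andbC.
  rewrite (sum_slow_level kn (fun v => slow_edge v (slow_vtx kn1 l))).
  under eq_bigl do rewrite slow_edge_eq.
  by rewrite big_pred1_eq.
rewrite (eq_bigl (fun v : slow_vertex n =>
   (tag v == k :> nat) && slow_edge v (slow_vtx kn1 l))).
  rewrite (sum_slow_level kn0 (fun v => slow_edge v (slow_vtx kn1 l))).
  by apply: eq_bigl => m; exact: slow_edge_succ.
move=> v; rewrite andbC; case e: slow_edge; rewrite ?andbF // !andbT.
case: (slow_edge_tag e) => /= E; first by rewrite -E eqxx (gtn_eqF (ltnSn k)).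
by case: E => <-; rewrite eqxx (ltn_eqF (ltnSn k)).
Qed.

Lemma sum_slow_edge_top n (kn0 : (n < n.+1)%N)
    (kn1 : (n.+1 < n.+2)%N) (l : part n.+1) (F : slow_vertex n -> V) :
  \sum_(v | slow_edge v (slow_vtx kn1 l)) F v =
  \sum_(m : part n | contained m l) F (slow_vtx kn0 m).
Proof.
rewrite (eq_bigl (fun v : slow_vertex n =>
   (tag v == n :> nat) && slow_edge v (slow_vtx kn1 l))).
  rewrite (sum_slow_level kn0 (fun v => slow_edge v (slow_vtx kn1 l))).
  by apply: eq_bigl => m; exact: slow_edge_succ.
move=> v; case e: slow_edge; rewrite ?andbF // !andbT.
case: (slow_edge_tag e) => /= E; last by case: E => <-; rewrite eqxx.
by have := ltn_ord (tag v); rewrite -E ltnn.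
Qed.

Lemma sum_slow_edge0 n (kn : (0 < n.+1)%N) (kn1 : (0 < n.+2)%N) (l : part 0)
    (F : slow_vertex n -> V) :
  \sum_(v | slow_edge v (slow_vtx kn1 l)) F v = F (slow_vtx kn l).
Proof.
rewrite (eq_bigl (fun v : slow_vertex n =>
   (tag v == 0 :> nat)%N && slow_edge v (slow_vtx kn1 l))).
  rewrite (sum_slow_level kn (fun v => slow_edge v (slow_vtx kn1 l))).
  under eq_bigl do rewrite slow_edge_eq.
  by rewrite big_pred1_eq.
move=> v; case e: slow_edge; rewrite ?andbF // !andbT.
by case: (slow_edge_tag e) => /= E; rewrite -?E.
Qed.

End SlowYoung.

(** * Identification of the characters of R_n *)

Lemma part1_uniq (l l' : part 1) : l = l'.
Proof.
apply: rows_eq; suff r1 (m : part 1) : rows m = [:: 1%N] by rewrite !r1.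
have /andP[_ /eqP m1] := part_valP m.
have := size_rows m; rewrite -[map _ _]/(rows m) in m1 *.
by case: (rows m) m1 => [|x [|]] //=; rewrite addn0 => ->.
Qed.

Section Identification.
Import mathcomp.boot.fintype mathcomp.boot.finset.
Variables (R : realType)
  (chiS : forall n, young n -> 'S_n -> R[i])
  (chiR : forall n, slow_young n -> rook n -> R[i])
  (indexing : standard_indexing chiS chiR).

Let BS := indexing_S indexing.
Let BR := indexing_R indexing.

(** * The apex of the character labelled by a vertex *)

Lemma chiR_apex n (v : slow_vertex n) : exists k, has_apex (chiR v) k.
Proof. exact/irreducible_char_apex/(branching_irr BR). Qed.

Lemma chiR_incl n (w : slow_vertex n.+1) x :
  chiR w (rook_incl x) = \sum_(v : slow_vertex n | slow_edge v w) chiR v x.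
Proof. exact: (branching_restr BR). Qed.

Lemma chiS_incl n (w : part n.+1) p :
  chiS (w : young n.+1) (perm_incl p) =
  \sum_(v : part n | contained v w) chiS (v : young n) p.
Proof. exact: (branching_restr BS). Qed.

(** Without a predecessor of [l], the branching rule would give [chiS l] the value 0 at the
    identity, but this value is a positive dimension. *)
Lemma part_pred n (l : part n.+1) : exists m : part n, contained m l.
Proof.
have [d d_gt0 ld] := irreducible_char1 (branching_irr BS (l : young n.+1)).
apply/existsP; apply: contraTT d_gt0 => /existsPn ml.
rewrite -leqNgt leqn0 -(pnatr_eq0 R[i]) -ld -perm_incl1 chiS_incl big_pred0 // => m.
exact: negbTE.
Qed.

Lemma has_apex_ge0 n (f : rook n -> R[i]) k K : has_apex f k -> 0 <= f (rook_id K).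
Proof. by case=> _ _ _ _ [c c0 ->]; rewrite mulrn_wge0 // ltW. Qed.

(** Since values at idempotents are nonnegative, this criterion detects the apex even in a sum of
    characters. *)
Lemma has_apex_gt0 n (f : rook n -> R[i]) k K :
  has_apex f k -> (0 < f (rook_id K)) = (k <= #|K|)%N.
Proof. by case=> _ _ _ _ [c c0 ->]; rewrite pmulrn_rgt0 // bin_gt0. Qed.

Lemma has_apex1_gt0 n (f : rook n -> R[i]) k : has_apex f k -> 0 < f 1%g.
Proof.
by move=> fk; rewrite -rook_idT (has_apex_gt0 _ fk) cardsT card_ord; case: fk.
Qed.

(* C(1, k) c = C(m, k) c = 1 with m > 1 forces k = 0. *)
Lemma has_apex0 n (f : rook n -> R[i]) k (K L : {set 'I_n}) :
  has_apex f k -> #|K| = 1%N -> (1 < #|L|)%N ->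
  f (rook_id K) = 1 -> f (rook_id L) = 1 -> has_apex f 0.
Proof.
move=> fk K1 L1; case: (fk) => _ _ _ _ [c _ fE]; rewrite !fE K1.
case: k {fE} fk => [//|[|k]] fk; last first.
  by rewrite bin_small // mulr0n => /eqP; rewrite eq_sym oner_eq0.
rewrite binn bin1 mulr1n => -> /eqP; rewrite -[X in _ == X]mulr1n eqr_nat.
by rewrite gtn_eqF.
Qed.

(** At included idempotents the branching rule shows that the apex of [w] is one more than the least
    apex below it. But these idempotents have rank at least 1, so when the least apex below is 0,
    both 0 and 1 remain possible for [w] and are separated by other means. *)
Lemma chiR_apex_step n : (0 < n)%N ->
  (forall v : slow_vertex n, has_apex (chiR v) (tag v)) ->
  forall w : slow_vertex n.+1, has_apex (chiR w) (tag w).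
Proof.
move=> n_gt0 IH; elim/slow_vtxP => k kn l; change (has_apex (chiR (slow_vtx kn l)) k).
have [k' wk'] := chiR_apex (slow_vtx kn l).
have le_iff (K : {set 'I_n}) : (k' <= #|K|.+1)%N =
    (0 < \sum_(v : slow_vertex n | slow_edge v (slow_vtx kn l)) chiR v (rook_id K)).
  rewrite -chiR_incl; have [L <- ->] := rook_incl_id K.
  by rewrite (has_apex_gt0 L wk').
have IH0 (v : slow_vertex n) (K : {set 'I_n}) : 0 <= chiR v (rook_id K).
  by exact: has_apex_ge0 (IH v).
case: k kn l wk' le_iff => [|k] kn l wk' le_iff.
  (* Empty diagram: the restriction to [R_n] is trivial, and idempotents of ranks 1 and [n.+1 > 1]
     then force apex 0. *)
  have one x : chiR (slow_vtx kn l) (rook_incl x) = 1.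
    rewrite chiR_incl (sum_slow_edge0 (ltn0Sn n)).
    by have [_ _ _ -> //] := IH (slow_vtx (ltn0Sn n) l).
  have [K K0] := ord_set_card (leq0n n).
  have [K' K'K K'E] := rook_incl_id K.
  have [T' T'T T'E] := rook_incl_id [set: 'I_n].
  apply: (has_apex0 wk' (K := K') (L := T')).
  - by rewrite K'K K0.
  - by rewrite T'T cardsT card_ord.
  - by rewrite -K'E one.
  - by rewrite -T'E one.
suff kk' : k' = k.+1 by have := wk'; rewrite kk'.
have [m ml] := part_pred l.
have kn' : (k < n.+1)%N by [].
have k'_le : (k' <= k.+1)%N.
  have [K Kk] : exists K : {set 'I_n}, #|K| = k by exact: ord_set_card.
  rewrite -Kk le_iff (bigD1 (slow_vtx kn' m)) ?slow_edge_succ //=.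
  rewrite ltr_pwDl ?sumr_ge0 //.
  by rewrite (has_apex_gt0 K (IH (slow_vtx kn' m))) Kk.
apply/eqP; rewrite eqn_leq k'_le /=.
case: k kn l wk' le_iff m ml kn' k'_le => [|k] kn l wk' le_iff m ml kn' k'_le.
  (* One cell: apex 0 would give the value 1 at the identity, but the empty diagram already
     contributes 1 and [(n, l)], present because [n > 0], a positive dimension. *)
  rewrite lt0n; apply/eqP => k'0; have [_ _ _ /(_ k'0) one _] := wk'.
  have := one (rook_incl 1%g); rewrite chiR_incl.
  have kn2 : (1 < n.+1)%N by [].
  rewrite (sum_slow_edge_lt kn2 kn') (bigD1 m) //= [X in _ + X]addrC addrA.
  have -> : chiR (slow_vtx kn' m) 1%g = 1 by have [_ _ _ -> //] := IH (slow_vtx kn' m).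
  move/eqP; rewrite -subr_eq0 addrK paddr_eq0; last 2 first.
  - exact/ltW/(has_apex1_gt0 (IH (slow_vtx kn2 l))).
  - by apply: sumr_ge0 => v _; exact/ltW/(has_apex1_gt0 (IH (slow_vtx kn' v))).
  by rewrite gt_eqF //; exact: (has_apex1_gt0 (IH (slow_vtx kn2 l))).
(* At least two cells: all lower neighbours have apex above [k] and vanish at an idempotent of rank
   [k]. *)
rewrite ltnNge.
have [K Kk] : exists K : {set 'I_n}, #|K| = k.
  by apply: ord_set_card; rewrite -ltnS ltnW.
rewrite -Kk le_iff big1 ?ltxx // => v e.
have := has_apex_gt0 K (IH v); rewrite lt0r IH0 andbT Kk.
have -> : (tag v <= k)%N = false.
  apply: negbTE; rewrite -ltnNge.
  by case: (slow_edge_tag e) => /= [<-|[<-]].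
by move/negbFE/eqP.
Qed.

Lemma chiR_apex0 (v : slow_vertex 0) : has_apex (chiR v) (tag v).
Proof.
elim/slow_vtxP: v => k kn l; have [k' vk'] := chiR_apex (slow_vtx kn l).
have [k'0 _ _ _ _] := vk'; rewrite leqn0 in k'0.
case: k kn l vk' => // kn l vk'; rewrite (eqP k'0) in vk'.
exact: vk'.
Qed.

(** Every vertex of level 1 has the root as its only lower neighbour. So all characters of [R_1]
    agree at the identity and can differ only at the empty map. *)
Lemma chiR1_incl (w : slow_vertex 1) : chiR w (rook_incl 1%g) = 1.
Proof.
have one (v : slow_vertex 0) : chiR v 1%g = 1.
  have [_ _ _ -> //] := chiR_apex0 v.
  by elim/slow_vtxP: v => -[].
rewrite chiR_incl; elim/slow_vtxP: w => -[|[|//]] kn l.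
  by rewrite (sum_slow_edge0 (ltn0Sn 0)) one.
have [m ml] := part_pred l.
rewrite (sum_slow_edge_top (ltn0Sn 0)) (bigD1 m) //= big1 ?addr0 ?one // => m' /andP[_].
by rewrite (part0_uniq m') (part0_uniq m) eqxx.
Qed.

(* If (1, one cell) were the trivial character, then (2, 1 + 1) would be trivial
   on R_1, hence trivial, but its restriction to S_2 is not. *)
Lemma chiR_apex1_cell (kn : (1 < 2)%N) (l : part 1) : has_apex (chiR (slow_vtx kn l)) 1.
Proof.
have [k' lk'] := chiR_apex (slow_vtx kn l).
have [k'1 _ _ one _] := lk'.
suff k'0 : k' <> 0%N by case: k' lk' k'1 k'0 {one} => [|[|]].
move=> /one {}one.
have [l11 l11E] : exists l : part 2, rows l = [:: 1; 1]%N by exact: part_of_rows.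
have [l2 l2E] : exists l : part 2, rows l = [:: 2; 0]%N by exact: part_of_rows.
have wone x : chiR (slow_vtx (ltnSn 2) l11) (rook_incl x) = 1.
  have [m ml] := part_pred l11.
  rewrite chiR_incl (sum_slow_edge_top kn) (bigD1 m) //= big1 ?addr0.
    by rewrite (part1_uniq m l) one.
  by move=> m' /andP[_]; rewrite (part1_uniq m' m) eqxx.
have [k2 wk2] := chiR_apex (slow_vtx (ltnSn 2) l11).
have [K K0] := ord_set_card (leq0n 1).
have [K' K'K K'E] := rook_incl_id K.
have [T' T'T T'E] := rook_incl_id [set: 'I_1].
have w0 : has_apex (chiR (slow_vtx (ltnSn 2) l11)) 0.
  apply: (has_apex0 wk2 (K := K') (L := T')).
  - by rewrite K'K K0.
  - by rewrite T'T cardsT card_ord.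
  - by rewrite -K'E wone.
  - by rewrite -T'E wone.
suff : l11 = l2 by move/(congr1 (@rows 2)); rewrite l11E l2E.
apply: (branching_inj BS (n := 2)) => p.
rewrite (indexing_row indexing (l := l2)) ?l2E // -(indexing_SR indexing).
have [_ _ _ w1 _] := w0.
exact: w1.
Qed.

(** If the empty diagram had apex 1 too, its character and that of the cell would both vanish at the
    empty map, hence coincide, against the injectivity of the labelling. *)
Lemma chiR_apex1 (w : slow_vertex 1) : has_apex (chiR w) (tag w).
Proof.
elim/slow_vtxP: w => -[|[|//]] kn l; last exact: chiR_apex1_cell.
have [k' lk'] := chiR_apex (slow_vtx kn l).
have [k'1 _ _ _ _] := lk'.
case: k' lk' k'1 => [|[|//]] lk' _ //.
have [m mE] : exists m : part 1, rows m = [:: 1]%N by exact: part_of_rows.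
have mk := chiR_apex1_cell (ltnSn 1) m.
suff /(congr1 (fun v : slow_vertex 1 => tag v : nat)) :
  slow_vtx kn l = slow_vtx (ltnSn 1) m by [].
apply: (branching_inj BR (n := 1)) => s.
have [_ l0 _ _ _] := lk'; have [_ m0 _ _ _] := mk.
have [s0|] := ltnP #|rook_im s| 1; first by rewrite l0 ?m0.
move=> /card_gt0P[j /rook_imP[a sa]].
suff -> : s = 1%g by rewrite -rook_incl1 !chiR1_incl.
by apply: rookP => b; rewrite rook1E (ord1 b) -{1}(ord1 a) sa (ord1 j).
Qed.

Lemma chiR_apexE n (v : slow_vertex n) : has_apex (chiR v) (tag v).
Proof.
case: n v => [|n]; first exact: chiR_apex0.
elim: n => [|n IH]; first exact: chiR_apex1.
exact: chiR_apex_step.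
Qed.

(** * Values at partial permutations of rank [|lambda|] *)

Lemma chiR_acts_as_top n (nn : (n < n.+1)%N) (l : part n) x (t : 'I_n -> 'I_n) p :
  acts_as x t p -> chiR (slow_vtx nn l) x = chiS (l : young n) p.
Proof.
move=> xp; rewrite -(indexing_SR indexing).
rewrite (acts_as_class _ xp (acts_as_rook_of_perm p)); last first.
  by move=> y z; exact: irreducible_charC (branching_irr BR _).
by rewrite (bool_irrelevance nn (ltnSn n)).
Qed.

Lemma chiR_acts_as n (v : slow_vertex n) x (t : 'I_(tag v) -> 'I_n) p :
  acts_as x t p -> chiR v x = chiS (tagged v : young (tag v)) p.
Proof.
elim: n v x t p => [|n IH]; elim/slow_vtxP => k kn l x t p /= xp.
  by case: k kn l t p xp => // kn l t p xp; exact: chiR_acts_as_top xp.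
have [kE|k_neq] := eqVneq k n.+1.
  by move: kE kn l t p xp => -> kn l t p; exact: chiR_acts_as_top.
have kn' : (k < n.+1)%N by rewrite ltn_neqAle k_neq -ltnS.
have [_ _ expand w0 _] := chiR_apexE (slow_vtx kn l).
case: k k_neq kn kn' l t p xp expand w0 => [|k] k_neq kn kn' l t p xp expand w0.
  rewrite w0 // (indexing_row indexing (l := l)) //.
  by rewrite nth_default ?size_rows.
have chiC y z : chiR (slow_vtx kn l) (y * z)%g = chiR (slow_vtx kn l) (z * y)%g.
  exact: irreducible_charC (branching_irr BR _).
have chiSC (y z : 'S_k.+1) :
    chiS (l : young k.+1) (y * z)%g = chiS (l : young k.+1) (z * y)%g.
  exact: irreducible_charC (branching_irr BS _).
have kn0 : (k < n.+1)%N by exact: ltnW.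
have IHv (m : part k) y u q :
    acts_as y u q -> chiR (slow_vtx kn0 m) y = chiS (m : young k) q.
  exact: (IH (slow_vtx kn0 m)).
have [[i pii]|pN] := pselect (exists i, p i = i).
  (* The fixed point is moved to the end, and [x] is replaced by the inclusion of some [y] of rank
     [k]. There [(n, l)], of apex [k.+1], contributes 0, and the two branching rules agree term by
     term. *)
  have [q [p' qp]] := perm_incl_conj pii.
  have [y yp] := acts_as_exists p' (@widen_ord_injective k n kn0).
  have := acts_as_conj q xp; rewrite qp => xp'.
  rewrite (acts_as_class chiC xp' (acts_as_incl yp)).
  have -> : chiS (l : young k.+1) p = chiS (l : young k.+1) (perm_incl p').
    by rewrite -qp -mulgA chiSC mulgKV.
  rewrite chiS_incl chiR_incl (sum_slow_edge_lt kn' kn0).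
  have [_ y0 _ _ _] := chiR_apexE (slow_vtx kn' l).
  by rewrite y0 ?add0r ?ltnS ?(card_im_acts_as yp) //;
    apply: eq_bigr => m _; exact: IHv yp.
(* Now [p] is realised by [y] in [R_n]. The vertices of size [k] vanish at [y], since a [k]-element
   fixed set would come from a fixed point of [p]; only [(n, l)] remains. *)
have [y yp] := acts_as_exists p (@widen_ord_injective k.+1 n kn').
have yI := acts_as_incl yp.
have := chiR_incl (slow_vtx kn l) y.
rewrite (sum_slow_edge_lt kn' kn0) [X in _ = _ + X]big1 ?addr0; last first.
  move=> m _; have [_ _ -> _ _] := chiR_apexE (slow_vtx kn0 m).
  rewrite big1 // => K /(fixed_sets_acts_as yp)[i pii].
  by case: pN; exists i.
rewrite (IH (slow_vtx kn' l) _ _ _ yp) /= => <-.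
have fix_max i : perm_incl p i = i -> i = ord_max.
  case: (unliftP ord_max i) => [j ->|//].
  rewrite /perm_incl lift_perm_lift => /lift_inj pj.
  by case: pN; exists j.
pose t' := extend_max (@widen_ord k.+1 n kn').
have tE j : t' (lift ord_max j) = lift ord_max (@widen_ord k.+1 n kn' j).
  by rewrite /t' /extend_max liftK.
have maxK := acts_as_fixed_sets yI (lift_perm_id ord_max ord_max p).
(* On its [k.+2] points [rook_incl y] fixes only the added one. Its only fixed set of size [k.+1] is
   therefore the rest, where it acts as [p], like [x]. *)
rewrite (expand (rook_incl y)) (big_pred1 (t' @: [set~ ord_max])) => [|K]; last first.
  apply/idP/eqP => [KF|->].
    by have [i /fix_max ->] := fixed_sets_acts_as yI KF.
  exact: maxK.
apply: (acts_as_class (t := t) (p := p)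
  (u := lift ord_max \o @widen_ord k.+1 n kn')) xp _ => //.
have [_ yt _] := yI.
split=> [i j /= /lift_inj /widen_ord_injective //|i|a ta]; rewrite rook_id_mulE.
  rewrite /= -tE imset_f; first by rewrite yt /perm_incl lift_perm_lift -/t' tE.
  by rewrite !inE eq_sym neq_lift.
case: ifP => // /imsetP[b]; rewrite !inE; case: (unliftP ord_max b) => [j ->|->].
  by rewrite tE => _ /ta.
by rewrite eqxx.
Qed.

End Identification.

(** * Central measures on the Pascal graph *)

Section PathMeasures.
Import numFieldNormedType.Exports measurable_realfun.
Local Open Scope classical_set_scope.

Lemma measurable_cylinder (G : graded_graph) (x : gpath G) n :
  measurable (cylinder x n : set (path_space G)).
Proof. by apply: sub_sigma_algebra; exists x, n. Qed.

(** The set is a countable union over the values of [code], which records the first [n.+1] vertices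
    as numbers; each piece is empty or a cylinder. *)
Lemma measurable_initial (G : graded_graph) n (A : set (path_space G)) :
    (forall x y : path_space G, (forall i, (i <= n)%N -> y i = x i) -> A x -> A y) ->
  measurable A.
Proof.
move=> AP; pose code (x : path_space G) := [seq pickle (x i) | i <- iota 0 n.+1].
have codeP x y : code y = code x -> forall i, (i <= n)%N -> y i = x i.
  move=> /eq_in_map yx i ni; apply: (pcan_inj pickleK).
  by apply: yx; rewrite mem_iota.
have -> : A = \bigcup_(s : seq nat) [set x | code x = s /\ A x].
  apply/seteqP; split=> [x Ax|x [s _ []//]].
  by exists (code x).
apply: countable_bigcupT_measurable; first exact: countableP.
move=> s.
have [[x [<- Ax]]|sN] := pselect (exists x, code x = s /\ A x); last first.
  suff -> : [set x | code x = s /\ A x] = set0 by [].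
  by apply/seteqP; split=> // x xs; apply: sN; exists x.
suff -> : [set y | code y = code x /\ A y] = cylinder x n by exact: measurable_cylinder.
apply/seteqP; split=> [y [/codeP]|y yx] //.
have yx' i : (i <= n)%N -> y i = x i by exact: yx.
split; last exact: AP Ax.
by apply/eq_in_map => i; rewrite mem_iota /= => /yx' ->.
Qed.

Lemma cyl_weightE (G : graded_graph) (R : realType) (M : probability (path_space G) R)
    (x : path_space G) n :
  central M -> M (cylinder x n) = (cyl_weight M (x n))%:E.
Proof.
move=> cM; rewrite /cyl_weight fineK; last first.
  by apply: fin_num_measure; exact: measurable_cylinder.
apply: cM; apply/esym.
by apply: (@xgetPex _ point [set y : path_space G | y n = x n]); exists x.
Qed.

Section Pascal.

Lemma pascal_path (f : nat -> nat) :
    f 0 = 0 -> (forall i, f i.+1 = f i \/ f i.+1 = (f i).+1) ->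
  exists x : path_space pascal, forall i, (x i : 'I_i.+1) = f i :> nat.
Proof.
move=> f0 fS; have f_le i : (f i < i.+1)%N.
  elim: i => [|i IH]; first by rewrite f0.
  by case: (fS i) => ->; rewrite ltnS // ltnW.
have fP i :
    gedge (g := pascal) (Ordinal (f_le i) : pascal i) (Ordinal (f_le i.+1) : pascal i.+1).
  by rewrite /= /pascal_edge /=; case: (fS i) => ->; rewrite eqxx ?orbT.
by exists (@GPath pascal (fun i => Ordinal (f_le i)) fP).
Qed.

Let ht (x : path_space pascal) i : nat := (x i : 'I_i.+1).

Lemma pascal_step x i : ht x i.+1 = ht x i \/ ht x i.+1 = (ht x i).+1.
Proof. by have /orP[/eqP|/eqP] := gpathP x i; [left|right]. Qed.

Lemma pascal_path_eq (x y : path_space pascal) i : ht x i = ht y i -> x i = y i.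
Proof. exact: val_inj. Qed.

Lemma pascal_extend (x : path_space pascal) n (b : bool) : exists y : path_space pascal,
  (forall i, (i <= n)%N -> y i = x i) /\ ht y n.+1 = (ht x n + b)%N.
Proof.
(* After level [n] the path makes the step [b] and then stays at constant height. *)
pose f i := if (i <= n)%N then ht x i else (ht x n + b)%N.
have [||y yf] := @pascal_path f.
- by rewrite /f /= /ht; case: (x 0) => -[].
- move=> i; rewrite /f; case: (ltngtP i n) => [ni|ni|->].
  + exact: pascal_step.
  + by left.
  + by case: (b); [right; rewrite addn1|left; rewrite addn0].
exists y; split=> [i ni|]; last by rewrite /ht yf /f ltnn.
by apply: pascal_path_eq; rewrite /ht yf /f ni.
Qed.

Lemma pascal_cylinder_split (z zs zu : path_space pascal) k :
    (forall i, (i <= k)%N -> zs i = z i) -> ht zs k.+1 = ht z k ->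
    (forall i, (i <= k)%N -> zu i = z i) -> ht zu k.+1 = (ht z k).+1 ->
  cylinder z k = cylinder zs k.+1 `|` cylinder zu k.+1 /\
  cylinder zs k.+1 `&` cylinder zu k.+1 = set0.
Proof.
move=> zsz zsS zuz zuS; split.
  apply/seteqP; split=> y; last first.
    by case=> yz i ik; rewrite yz ?(ltnW ik) // ?zsz ?zuz // ltnW.
  move=> yz; have yk : ht y k = ht z k by rewrite /ht yz.
  have [yS|yS] := pascal_step y k; [left|right] => i;
    rewrite leq_eqVlt => /orP[/eqP ->|ik].
  - by apply: pascal_path_eq; rewrite yS yk zsS.
  - by rewrite zsz // yz.
  - by apply: pascal_path_eq; rewrite yS yk zuS.
  - by rewrite zuz // yz.
apply/seteqP; split=> // y [ys yu].
have : ht zs k.+1 = ht zu k.+1 by rewrite /ht -ys // -yu.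
by rewrite zsS zuS => /eqP; rewrite ltn_eqF.
Qed.

Variables (R : realType) (M : probability (path_space pascal) R).
Hypothesis cM : central M.

Let up i : set (path_space pascal) := [set y | ht y i.+1 = (ht y i).+1].

Lemma measurable_up i : measurable (up i).
Proof.
apply: (@measurable_initial _ i.+1) => x y yx.
by rewrite /up /= /ht !yx.
Qed.

(** Exchangeability: an up step at time [n + m] is as likely as one at time [n]. The cylinder is
    split at step [n], the induction hypothesis applies to both halves, and centrality replaces
    straight-then-up by up-then-straight. *)
Lemma measure_cylinder_up n m (x xu : path_space pascal) :
    (forall i, (i <= n)%N -> xu i = x i) -> ht xu n.+1 = (ht xu n).+1 ->
  M (cylinder x n `&` up (n + m)) = M (cylinder xu n.+1).
Proof.
elim: m n x xu => [|m IH] n x xu xux xuS.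
  rewrite addn0; congr (M _); apply/seteqP; split=> y.
    move=> [yx yup] i; rewrite leq_eqVlt => /orP[/eqP ->|ni]; last by rewrite xux // yx.
    by apply: pascal_path_eq; rewrite yup xuS /ht xux // yx.
  move=> yxu; split=> [i ni|]; first by rewrite yxu ?xux // ltnW.
  by rewrite /up /= {1}/ht yxu // -/(ht _ _) xuS /ht yxu.
have [xs [xsx xsS]] := pascal_extend x n false.
have [xsu [xsux xsuS]] := pascal_extend xs n.+1 true.
have [xus [xusx xusS]] := pascal_extend xu n.+1 false.
have [xuu [xuux xuuS]] := pascal_extend xu n.+1 true.
have xun : ht xu n = ht x n by rewrite /ht xux.
rewrite addn0 in xsS; rewrite addn1 in xsuS.
rewrite addn0 in xusS; rewrite addn1 in xuuS.
have xuS' : ht xu n.+1 = (ht x n).+1 by rewrite xuS xun.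
have [-> xsxu] := pascal_cylinder_split xsx xsS xux xuS'.
have [xuE xuD] := pascal_cylinder_split xusx xusS xuux xuuS.
have mc z k := @measurable_cylinder pascal z k.
have mup k := measurable_up k.
rewrite setIUl measureU; last 3 first.
- exact: measurableI.
- exact: measurableI.
- by rewrite setIACA xsxu set0I.
rewrite -(addSnnS n m).
have xsuS' : ht xsu n.+2 = (ht xsu n.+1).+1 by rewrite xsuS /ht xsux.
have xuuS' : ht xuu n.+2 = (ht xuu n.+1).+1 by rewrite xuuS /ht xuux.
apply: (eq_trans (congr2 adde (IH _ xs xsu xsux xsuS') (IH _ xu xuu xuux xuuS'))).
rewrite xuE measureU //; congr (_ + _)%E; apply: cM.
by apply: pascal_path_eq; rewrite xsuS xsS xusS xuS'.
Qed.

Lemma measurable_ht n (D : set (path_space pascal)) :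
  measurable_fun D (fun y => (ht y n)%:R : R).
Proof.
move=> mD Y mY; apply: measurableI => //.
by apply: (@measurable_initial _ n) => x y yx; rewrite /= /ht yx.
Qed.

(** Each of the [m] steps after level [n] adds to the integral the weight of going up at once. *)
Lemma integral_ht n m (x xu : path_space pascal) :
    (forall i, (i <= n)%N -> xu i = x i) -> ht xu n.+1 = (ht xu n).+1 ->
  (\int[M]_(y in cylinder x n) ((ht y (n + m))%:R)%:E =
   ((ht x n)%:R * cyl_weight M (x n) + m%:R * cyl_weight M (xu n.+1))%:E)%E.
Proof.
move=> xux xuS; have mc := @measurable_cylinder pascal x n.
elim: m => [|m IH].
  rewrite mul0r addr0 addn0 EFinM -(cyl_weightE _ _ cM) -integral_cst //.
  by apply: eq_integral => y; rewrite inE => yx; rewrite /ht yx.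
have -> : (\int[M]_(y in cylinder x n) ((ht y (n + m.+1))%:R)%:E =
    \int[M]_(y in cylinder x n) (((ht y (n + m))%:R)%:E + (\1_(up (n + m)) y)%:E))%E.
  apply: eq_integral => y _; rewrite addnS -EFinD; congr EFin.
  rewrite indicE; have [yS|yS] := pascal_step y (n + m); rewrite yS.
    rewrite memNset ?addr0 // /up /= yS => /eqP.
    by rewrite ltn_eqF.
  by rewrite mem_set ?natr1.
rewrite ge0_integralD //; last first.
- by apply/measurable_EFinP; apply: measurable_indic; exact: measurable_up.
- by apply/measurable_EFinP; exact: measurable_ht.
rewrite IH integral_indic //; last exact: measurable_up.
have := measure_cylinder_up m xux xuS; rewrite cyl_weightE // setIC => e.
apply: (eq_trans (congr1 (fun z => (_ + z)%E) e)); rewrite -EFinD.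
by rewrite -addrA -[in RHS]natr1 mulrDl mul1r.
Qed.

(** The integral of [k_f / f] over the cylinder tends to the weight of [xu] by [integral_ht], and to
    [delta] times the weight of [x] by dominated convergence. *)
Lemma cyl_weight_up (delta : R) n (x xu : path_space pascal) :
    {ae M, forall x : path_space pascal,
      (fun f : nat => (x f : 'I_f.+1)%:R / f%:R : R) @ \oo --> delta} ->
    (forall i, (i <= n)%N -> xu i = x i) -> ht xu n.+1 = (ht xu n).+1 ->
  cyl_weight M (xu n.+1) = delta * cyl_weight M (x n).
Proof.
move=> aeM xux xuS; have mc := @measurable_cylinder pascal x n.
set w := cyl_weight M (x n); set w' := cyl_weight M (xu n.+1).
pose f_ m (y : path_space pascal) : \bar R := ((ht y (n + m.+1))%:R / (n + m.+1)%:R)%:E.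
(* Here [harmonic (m + n)] is the inverse of the level [n + m.+1]; the limit [w'] has been split off
   from the quotient. *)
have f_int m : (\int[M]_(y in cylinder x n) f_ m y =
    (w' + ((ht x n)%:R * w - n%:R * w') * harmonic (m + n)%N)%:E)%E.
  have -> : f_ m = (fun y => ((n + m.+1)%:R^-1)%:E * ((ht y (n + m.+1))%:R)%:E)%E.
    by apply/funext => y; rewrite /f_ mulrC EFinM.
  rewrite ge0_integralZl //; last first.
    by apply/measurable_EFinP; exact: measurable_ht.
  rewrite (integral_ht _ xux xuS) -EFinM; congr EFin; rewrite /harmonic /= -/w -/w'.
  have nm : (n + m.+1)%:R != 0 :> R by rewrite pnatr_eq0 addnS.
  have -> : (m + n).+1 = (n + m.+1)%N by rewrite addnS addnC.
  apply: (mulfI nm); rewrite mulrA mulfV // mul1r.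
  by rewrite [RHS]mulrDr [X in _ = _ + X]mulrC divfK // natrD; ring.
have f_lim : (\int[M]_(y in cylinder x n) f_ m y)%E @[m --> \oo] --> w'%:E.
  under eq_fun do rewrite f_int.
  apply: cvg_EFin; first by near=> m.
  rewrite -[X in _ --> X]addr0; apply: cvgD; first exact: cvg_cst.
  rewrite -[X in _ --> X](mulr0 ((ht x n)%:R * w - n%:R * w')).
  apply: cvgM; first exact: cvg_cst.
  by have := @cvg_harmonic R; rewrite -(cvg_shiftn n).
have f_meas m : measurable_fun (cylinder x n : set (path_space pascal)) (f_ m).
  apply/measurable_EFinP; rewrite /f_.
  by apply: measurable_funM; [exact: measurable_ht|exact: measurable_cst].
have f_cvg : {ae M, forall y : path_space pascal,
    cylinder x n y -> f_ ^~ y @ \oo --> delta%:E}.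
  apply: filterS aeM => y yd _; apply: cvg_EFin; first by near=> m.
  rewrite (_ : fine \o f_ ^~ y = fun m => (ht y (m + n.+1))%:R / (m + n.+1)%:R).
    by move: yd; rewrite -(cvg_shiftn n.+1).
  by apply/funext => m; rewrite /f_ /= addnC addSnnS.
have one_int : M.-integrable (cylinder x n) (cst 1%E).
  exact: finite_measure_integrable_cst.
have f_le : {ae M, forall y : path_space pascal, forall m,
    cylinder x n y -> (`|f_ m y| <= cst 1 y)%E}.
  apply: aeW => y m _; rewrite /f_ /= lee_fin ger0_norm; last by rewrite divr_ge0.
  by rewrite ler_pdivrMr ?ltr0n ?addnS // mul1r ler_nat -ltnS ltn_ord.
have [_ _] := dominated_convergence mc f_meas (measurable_cst _) f_cvg one_int f_le.
rewrite integral_cst // => f_lim'; apply: EFin_inj; rewrite EFinM.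
apply: (eq_trans (cvg_unique (@ereal_hausdorff R) f_lim f_lim')).
exact: (congr1 (fun z => delta%:E * z)%E (cyl_weightE x n cM)).
Unshelve. all: by end_near.
Qed.

(** Along a path, an up step multiplies the weight by [delta], hence by additivity a straight step
    multiplies it by [1 - delta]. *)
Lemma cyl_weight_pascal (delta : R) n (k : 'I_n.+1) :
    {ae M, forall x : path_space pascal,
      (fun f : nat => (x f : 'I_f.+1)%:R / f%:R : R) @ \oo --> delta} ->
  cyl_weight M (k : pascal n) = delta ^+ k * (1 - delta) ^+ (n - k).
Proof.
move=> aeM.
suff wE (x : path_space pascal) m :
    cyl_weight M (x m) = delta ^+ ht x m * (1 - delta) ^+ (m - ht x m).
  (* The path climbs to height [k] and stays there, so it meets level [n] in [k]. *)
  have [||x xk] := @pascal_path (minn k); first by rewrite minn0.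
    by move=> m; lia.
  have -> : k = x n by apply: val_inj; rewrite /= xk (minn_idPl _) // -ltnS.
  exact: wE.
elim: m x => [|m IH] x.
  have -> : ht x 0 = 0%N by rewrite /ht; case: (x 0) => -[].
  rewrite expr0 mul1r expr0; apply: EFin_inj; rewrite -(cyl_weightE _ _ cM).
  rewrite (_ : cylinder x 0 = [set: path_space pascal]) ?probability_setT //.
  apply/seteqP; split=> // y _ i; rewrite leqn0 => /eqP ->.
  by rewrite (groot_uniq (x 0)) (groot_uniq (y 0)).
have [xs [xsx xsS]] := pascal_extend x m false.
have [xu [xux xuS]] := pascal_extend x m true.
rewrite addn0 in xsS; rewrite addn1 in xuS.
have xuS' : ht xu m.+1 = (ht xu m).+1 by rewrite xuS /ht xux.
have htm : (ht x m <= m)%N by rewrite -ltnS ltn_ord.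
have wu := cyl_weight_up aeM xux xuS'.
have [xS|xS] := pascal_step x m; last first.
  by rewrite (cyl_weight_up aeM (fun i _ => erefl (x i)) xS) IH xS subSS exprS mulrA.
have [xE xD] := pascal_cylinder_split xsx xsS xux xuS.
have -> : x m.+1 = xs m.+1 by apply: pascal_path_eq; rewrite xS xsS.
have wD : cyl_weight M (x m) = cyl_weight M (xs m.+1) + cyl_weight M (xu m.+1).
  apply: EFin_inj; rewrite EFinD -!(cyl_weightE _ _ cM) xE measureU //;
    exact: measurable_cylinder.
rewrite xS subSn // exprS mulrCA -IH mulrBl mul1r -wu wD; ring.
Qed.

End Pascal.

End PathMeasures.

(** * Thoma characters *)

Section Assembly.
Import mathcomp.boot.fintype mathcomp.boot.finset.

Lemma tildeE n k (s : rook n) (K : {set 'I_n}) i :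
  K \in fixed_sets s k -> tilde s K i = if i \in K then odflt i (s i) else i.
Proof.
rewrite inE => /andP[_ /eqP sK].
have sKK j : j \in K -> exists2 a, a \in K & s j = Some a.
  move=> jK; have : s j \in Some @: K by rewrite -sK imset_f.
  by case/imsetP => a; exists a.
pose f := [ffun i => if i \in K then odflt i (s i) else i].
have f_inj : injectiveb f.
  apply/injectiveP => a b; rewrite !ffunE.
  case: ifP => [/sKK[a' a'K sa]|aK]; case: ifP => [/sKK[b' b'K sb]|bK] //=.
  - by rewrite sa sb /= => ab; apply: (rook_inj sa); rewrite ab.
  - by rewrite sa /= => ab; rewrite ab bK in a'K.
  - by rewrite sb /= => ab; rewrite -ab aK in b'K.
have : val (tilde s K) = f by rewrite /tilde insubdK.
by rewrite -pvalE => ->; rewrite ffunE.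
Qed.

(** The nontrivial cycles of [tilde s K] are the images under [t] of those of [p]; the points off
    [K] are fixed and give no factor. *)
Lemma thoma_char_tilde (R : realType) (alpha beta : nat -> R) n k (s : rook n)
    (K : {set 'I_n}) (t : 'I_k -> 'I_n) (p : 'S_k) :
    K \in fixed_sets s k -> injective t -> K = t @: [set: 'I_k] ->
    (forall i, s (t i) = Some (t (p i))) ->
  thoma_char alpha beta (tilde s K) = thoma_char alpha beta p.
Proof.
move=> KF tI tK st; set q := tilde s K.
have qt i : q (t i) = t (p i) by rewrite /q (tildeE _ KF) st {1}tK imset_f.
have qXt j i : (q ^+ j)%g (t i) = t ((p ^+ j)%g i).
  by elim: j => [|j IH]; rewrite ?expg0 ?perm1 // !expgSr !permM IH qt.
have orb i : porbit q (t i) = t @: porbit p i.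
  apply/setP => y; apply/porbitP/imsetP => [[j ->]|[_ /porbitP[j ->] ->]].
    by exists ((p ^+ j)%g i); rewrite ?mem_porbit // qXt.
  by exists j; rewrite qXt.
have orb1 y : y \notin K -> #|porbit q y| = 1%N.
  move=> yK; have qy : q y = y by rewrite (tildeE _ KF) (negbTE yK).
  apply/eqP/cards1P; exists y; apply/setP => z; rewrite inE.
  apply/porbitP/eqP => [[j ->]|->]; last by exists 0%N; rewrite expg0 perm1.
  by elim: j => [|j IH]; rewrite ?expg0 ?perm1 // expgSr permM IH.
congr (_%:C).
pose big m (r : 'S_m) := [set X in porbits r | (1 < #|X|)%N].
have bigE m (r : 'S_m) (F : {set 'I_m} -> R) :
    \prod_(X in porbits r | (1 < #|X|)%N) F X = \prod_(X in big m r) F X.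
  by apply: eq_bigl => X; rewrite inE.
rewrite !bigE; have -> : big n q = [set t @: (X : {set 'I_k}) | X in big k p].
  apply/setP => X; apply/idP/imsetP => [|[Y]]; rewrite !inE.
    case/andP => /imsetP[y _ ->] y1.
    have : y \in K by apply: contraLR y1 => /orb1 ->.
    rewrite tK => /imsetP[i _ yE]; exists (porbit p i); last by rewrite yE orb.
    by rewrite inE imset_f //= -(card_imset _ tI) -orb -yE.
  case/andP => /imsetP[i _ ->] i1 ->.
  by rewrite -orb imset_f //= orb card_imset.
rewrite big_imset /=; last by move=> X Y _ _; exact: imset_inj.
by apply: eq_bigr => X _; rewrite card_imset.
Qed.

End Assembly.

(** * Summation over the diagrams for each fixed set *)

Theorem theorem2p12 (R : realType)
  (chiS : forall n, young n -> 'S_n -> R[i])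
  (chiR : forall n, slow_young n -> rook n -> R[i])
  (indexing : standard_indexing chiS chiR)
  (alpha beta : nat -> R) (delta : R)
  (thoma : thoma_parameters alpha beta) (delta01 : 0 <= delta <= 1)
  (chi : rook_inf -> R[i])
  (chi_abd : rook_character chiS chiR alpha beta delta chi)
  (sigma : rook_inf) (n : nat) (sigma_reduced : reduced sigma n)
  (s : rook n) (sE : to_inf s = sigma) :
  chi sigma =
    \sum_(0 <= k < n.+1)
      ((delta ^+ k * (1 - delta) ^+ (n - k))%:C *
       \sum_(K in fixed_sets s k) thoma_char alpha beta (tilde s K)).
Proof.
have [MY [MP [M [[_ MYc] [[MPc _] MPd] _ ME Mc]]]] := chi_abd.
rewrite -sE (Mc n s) big_mkord.
pose v (k : 'I_n.+1) (l : part k) : slow_young n :=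
  Tagged (fun k : 'I_n.+1 => part k) l.
transitivity (\sum_(k < n.+1) \sum_(l : part k)
  (cyl_weight M (v k l))%:C * chiR n (v k l) s).
  by rewrite sig_big_dep; apply: eq_big => -[k l].
apply: eq_bigr => k _.
have expand (l : part k) : chiR n (v k l) s =
    \sum_(K in fixed_sets s k) chiR n (v k l) (rook_id K * s)%g.
  by have [_ _ e _ _] := chiR_apexE indexing (v k l).
under eq_bigr do rewrite ME (cyl_weight_pascal MPc _ MPd) mulrC expand mulr_suml.
rewrite exchange_big mulr_sumr /=; apply: eq_bigr => K KF.
have [t [p [xp tK st]]] := fixed_set_acts_as KF.
have tI : injective t by case: xp.
(* The character of the infinite symmetric group is decomposed at level [k = |K|], not [n], which
   matches the sum over [l : part k]. *)
rewrite (thoma_char_tilde alpha beta KF tI tK st) (MYc k p) mulr_sumr.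
apply: eq_bigr => l _; rewrite (chiR_acts_as indexing (v := v k l) xp) /=.
by rewrite rmorphM /= mulrC mulrA [X in X * _]mulrC.
Qed.
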